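(* Let $p\in(0,1)$ and, for each integer $N\ge 3$, let $X_N^{(p)}$ be the normalized position of the survivor in the probabilistic elimination process with $N$ participants and parameter $p$; that is, $X_N^{(p)}$ is a random variable on $\mathbb{R}/\mathbb{Z}$ with $\mathbb{P}(X_N^{(p)}=n/N)=g_N(n,p)$ for $0\le n\le N-1$. Then the sequence $\left(X_N^{(p)}\right)_{N\ge 3}$ converges in law to a random variable supported in $\mathbb{R}/\mathbb{Z}$. Moreover: 1. For every $p\in(0,1)$, $X_N^{(p)}$ converges in law, as $N\to\infty$, to a random variable $X^{(p)}$ which is a Bernoulli random variable taking values in the set $\{0,1/2\}$. 2. If $p\in(1/3,2/3)$, then $X_N^{(p)}$ converges in probability to the constant $1/2$ as $N\to\infty$. 3. If $p=1/2$, write $X_N=X_N^{(1/2)}$, regarded as a real random variable with values in $[0,1)$, and assume that the random variables $(X_N)_{N\ge 3}$ are independent. Let $\mathbb{V}_N(X_N)$ denote the variance of $X_N$ and set $$B_L=\sqrt{\sum_{N=3}^{L}\mathbb{V}_N(X_N)}\qquad (L\ge 3).$$ Then $$\frac{1}{B_L}\sum_{N=3}^{L}\left(X_N-\frac12\right)\longrightarrow \mathcal{N}(0,1)\quad\text{in law as } L\to\infty,$$ where $\mathcal{N}(0,1)$ is the standard normal distribution, and $B_L\asymp\sqrt{\ln L}$; that is, there exist constants $C>c>0$ such that $c\le B_L/\sqrt{\ln L}\le C$ for all sufficiently large $L$.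
   Context: Probabilistic elimination process with $N\ge 3$ participants and parameter $p\in[0,1]$: the participants are labelled $0,1,\dots,N-1$ counterclockwise, regularly spaced on a unit circle (participant $n$ at position $n/N\in\mathbb{R}/\mathbb{Z}$); the right-hand neighbour of participant $n$ is $n+1$ and the left-hand neighbour is $n-1$ (mod $N$). Participant $0$ holds the knife first. With probability $p$ he eliminates participant $1$ (on his right) and the knife passes to participant $2$; with probability $1-p$ he eliminates participant $N-1$ (on his left) and the knife passes to participant $N-2$. At each later step, independently of the past choices, the current knife holder stabs in the same direction (right or left) as in the previous step with probability $p$ and in the opposite direction with probability $1-p$: he eliminates the nearest participant still alive in the chosen direction, and the knife passes to the next participant still alive beyond the victim in the direction of the stabbing. The process continues until a single participant, the survivor, remains. $g_N(n,p)$ denotes the probability that participant $n\in\{0,\dots,N-1\}$ is the survivor. The space $\mathbb{R}/\mathbb{Z}$ is identified with the unit circle, and also with $[0,1)$ when real values are needed. A Bernoulli random variable taking values in $\{0,1/2\}$ is one that lies in $\{0,1/2\}$ almost surely (it may be degenerate). *)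

(* Defs.v *)
From HB Require Import structures.
From mathcomp Require Import all_boot all_order all_algebra finmap.
From mathcomp Require Import all_classical all_reals all_analysis.
From mathcomp Require Import measurable_realfun.

Set Implicit Arguments.
Unset Strict Implicit.
Unset Printing Implicit Defensive.

Import Order.TTheory GRing.Theory Num.Theory.
Import numFieldNormedType.Exports.

Local Open Scope classical_set_scope.
Local Open Scope ring_scope.

Section elimination.
Local Open Scope nat_scope.

(* [alive] lists the participants still alive in counterclockwise order; [dir]
   is the direction of the previous stab, [true] being right. *)
Record state := State { alive : seq nat ; holder : nat ; dir : bool }.

Definition neighbour (d : bool) (s : seq nat) (i : nat) : nat :=
  if d then next s i else prev s i.

(* When two participants are left, the neighbour of the victim is the holder
   himself, who keeps the knife. *)
Definition stab (s : state) (same : bool) : state :=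
  let d := if same then dir s else ~~ dir s in
  let victim := neighbour d (alive s) (holder s) in
  State (rem victim (alive s)) (neighbour d (alive s) victim) d.

(* The first stab goes to the right with probability p, as if the previous one
   had gone to the right. *)
Definition initial_state (N : nat) : state := State (iota 0 N) 0 true.

(* Each stab removes one participant, so the process has exactly N - 1 steps;
   [c] records which of them repeat the previous direction. *)
Definition survives (N : nat) (c : N.-1.-tuple bool) (n : nat) : bool :=
  alive (foldl stab (initial_state N) c) == [:: n].

End elimination.

(* The N - 1 choices are independent, each one being [true] with probability p. *)
Definition survival_prob (R : realType) (p : R) (N n : nat) : R :=
  \sum_(c : N.-1.-tuple bool | survives c n)
    \prod_(same <- c) (if same then p else 1 - p).

Section circle.
Variable R : realType.

Definition eq_mod1 (x y : R) : bool := (x - y) \is a Num.int.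

Lemma eq_mod1_refl : reflexive eq_mod1.
Proof. by move=> x; rewrite /eq_mod1 subrr rpred0. Qed.

Lemma eq_mod1_sym : symmetric eq_mod1.
Proof. by move=> x y; rewrite /eq_mod1 -[x - y]opprB rpredN. Qed.

Lemma eq_mod1_trans : transitive eq_mod1.
Proof.
move=> y x z xy yz; rewrite /eq_mod1.
by rewrite -[x](subrK y) -addrA rpredD.
Qed.

Canonical eq_mod1_equiv :=
  EquivRel eq_mod1 eq_mod1_refl eq_mod1_sym eq_mod1_trans.

Definition circle : Type := quotient_topology {eq_quot eq_mod1_equiv}%qT.

HB.instance Definition _ := Topological.on circle.
HB.instance Definition _ := Quotient.on circle.
HB.instance Definition _ := isPointed.Build circle (\pi_circle 0)%qT.
HB.instance Definition _ :=
  Measurable.copy circle (g_sigma_algebraType (@open circle)).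

Definition to_circle (x : R) : circle := (\pi_circle x)%qT.

(* The identification of R/Z with [0,1) *)
Definition circle_val (x : circle) : R :=
  repr x - (Num.floor (repr x))%:~R.

Lemma circle_val_to_circle (x : R) :
  circle_val (to_circle x) = x - (Num.floor x)%:~R.
Proof.
rewrite /circle_val; set y := repr _.
have : eq_mod1_equiv y x by apply/eqmodP; exact: (reprK (to_circle x)).
rewrite /= /eq_mod1 => yx.
by rewrite -[y](subrK x) (floorDzr yx) rmorphD/= floorK// opprD addrACA subrr add0r.
Qed.

Lemma measurable_circle_val : measurable_fun [set: circle] circle_val.
Proof.
move=> _; apply: (measurability _ (RGenOInfty.measurableE R)) => //.
move=> /= _ [_ [a ->] <-]; rewrite setTI.
apply: sub_sigma_algebra.
have [a0|a0] := ltP a 0.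
  suff -> : circle_val @^-1` `]a, +oo[ = setT by exact: openT.
  apply/seteqP; split => // x _ /=; rewrite in_itv/= andbT.
  by rewrite (lt_le_trans a0)// subr_ge0 ge_floor.
rewrite /open/= /quotient_open.
suff -> : \pi_(circle)%qT @^-1` (circle_val @^-1` `]a, +oo[) =
    \bigcup_k `]k%:~R + a, (k + 1)%:~R[%classic.
  by apply: bigcup_open => k _; exact: interval_open.
apply/seteqP; split => [x|x [k _]] /=; rewrite !in_itv/= circle_val_to_circle andbT.
  by move=> ax; exists (Num.floor x) => //=; rewrite in_itv/= -ltrBrDl ax floorD1_gt.
move=> /andP[kax xk]; rewrite (@floor_def _ _ k) ?ltrBrDl ?xk ?andbT//.
by rewrite ltW// (le_lt_trans _ kax)// lerDl.
Qed.

HB.instance Definition _ := isMeasurableFun.Build _ _ circle R circle_val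
  measurable_circle_val.

(* The length of the shorter arc, for a circle of total length 1 *)
Definition circle_dist (x y : circle) : R :=
  let t := `|circle_val x - circle_val y| in Num.min t (1 - t).

End circle.

Section probability.
Variable R : realType.

Definition bounded_continuous (T : topologicalType) (f : T -> R) : Prop :=
  continuous f /\ exists M, forall x, `|f x| <= M.

Definition cvg_in_law_circle (mu_ : nat -> probability (circle R) R)
    (mu : probability (circle R) R) : Prop :=
  forall f : circle R -> R, bounded_continuous f ->
    (\int[mu_ n]_x (f x)%:E @[n --> \oo] --> \int[mu]_x (f x)%:E)%E.

(* [measurableTypeR R] is [R] with the same sigma-algebra under another
   display; it is the type on which the library defines [normal_prob]. *)
Definition cvg_in_law_real (mu_ : nat -> probability R R)
    (mu : probability (measurableTypeR R) R) : Prop :=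
  forall f : R -> R, bounded_continuous f ->
    (\int[mu_ n]_x (f x)%:E @[n --> \oo] --> \int[mu]_x (f x)%:E)%E.

(* Since the limit is a constant, the X N may live on different spaces. *)
Definition cvg_in_probability_cst (d : nat -> measure_display)
    (Omega : forall N, measurableType (d N))
    (P : forall N, probability (Omega N) R)
    (X : forall N, {RV (P N) >-> circle R}) (c : circle R) : Prop :=
  forall e : R, 0 < e ->
    P N [set w | e <= circle_dist (X N w) c] @[N --> \oo] --> 0%E.

Definition mutually_independent d d' (Omega : measurableType d)
    (T : measurableType d') (P : probability Omega R) (I : set nat)
    (X : nat -> {RV P >-> T}) : Prop :=
  forall (J : {fset nat}) (A : nat -> set T),
    [set` J] `<=` I -> (forall j, measurable (A j)) ->
    (P (\bigcap_(j in [set` J]) (X j @^-1` A j)) =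
      \prod_(j <- J) P (X j @^-1` A j))%E.

Definition is_survivor_position d (Omega : measurableType d)
    (P : probability Omega R) (p : R) (N : nat) (X : {RV P >-> circle R}) :
    Prop :=
  forall n, (n < N)%N ->
    P (X @^-1` [set to_circle (n%:R / N%:R)]) = (survival_prob p N n)%:E.

Definition real_position d (Omega : measurableType d)
    (P : probability Omega R) (X : {RV P >-> circle R}) : {RV P >-> R} :=
  @circle_val R \o X.

Definition total_deviation d (Omega : measurableType d)
    (P : probability Omega R) (X : nat -> {RV P >-> R}) (L : nat) : R :=
  Num.sqrt (\sum_(3 <= N < L.+1) fine 'V_P[X N]).

Definition normalized_sum d (Omega : measurableType d)
    (P : probability Omega R) (X : nat -> {RV P >-> R}) (L : nat) :
    {RV P >-> R} :=
  (total_deviation X L)^-1 *: \sum_(3 <= N < L.+1) (X N - cst (1 / 2)).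

End probability.

(* Main.v *)
Require Import Defs.
From HB Require Import structures.
From mathcomp Require Import all_boot all_order all_algebra finmap.
From mathcomp Require Import all_classical all_reals all_analysis.
From mathcomp Require Import measurable_realfun.
From mathcomp Require Import zify ring lra.

(** Relabelling the participants from the new knife holder, in the direction of
    the last stab, turns the process with N participants into the process with
    N - 1 participants.  Hence the label S_N of the survivor is obtained from
    S_(N-1) by

      S_N = (S_(N-1) + 2) mod N  with probability p,
      S_N = N - 2 - S_(N-1)      with probability 1 - p.

    In terms of Z_N = S_N - N / 2 the two moves are Z |-> Z + 3 / 2, up to the
    wrap-around from N / 2 to - N / 2, and Z |-> - (Z + 3 / 2).  The square does
    not see the wrap-around, so that E[Z_N^2] = E[Z_(N-1)^2] + 3 E[Z_(N-1)] + 9 / 4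
    exactly, while E[Z_N] = (2 p - 1) (E[Z_(N-1)] + 3 / 2) up to the error
    N P(S_N = 0) due to the wrap-around.  Near the label 0 the distance to 0
    drifts away at mean speed 1 / 2; an exponential Lyapunov function
    ([edge_decay]) makes P(S_N = 0) decay geometrically.  So E[Z_N] is bounded
    and E[Z_N^2] = O(N), and Chebyshev's inequality gives S_N / N -> 1 / 2 in
    probability for every p in (0, 1): the limit law is always the Dirac mass at
    1 / 2, which is a degenerate Bernoulli law on {0, 1/2}.

    For p = 1 / 2 the same recursions are sharper: the sum of the |E[Z_N]| is
    finite and E[Z_N^2] = 9 N / 4 + O(1).  The variance of X_N is then
    9 / (4 N) + O(1 / N^2), so that B_L^2 = (9 / 4) ln L + O(1), and the centering
    at 1 / 2 instead of the mean only costs a bounded total.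

    The central limit theorem is Lindeberg's replacement argument for variables
    with finitely many values.  Independence turns E[f(sum)] into a composition
    of averaging operators applied to f ([independent_smears]).  On the heat
    kernel each operator acts, up to a Taylor remainder, as an increase of the
    time parameter by the variance ([smear_kernel]), because the kernel solves
    the heat equation; the remainders add up to O(1 / B_L) ([smears_kernel]).  A
    continuous function with compact support is uniformly close to its
    convolution with a narrow heat kernel, which transfers the result to such
    functions, and a cutoff extends it to all bounded continuous functions
    ([lindeberg_bounded_continuous]). *)

Set Implicit Arguments.
Unset Strict Implicit.
Unset Printing Implicit Defensive.

Import Order.TTheory GRing.Theory Num.Theory.
Import numFieldNormedType.Exports.

Local Open Scope classical_set_scope.
Local Open Scope ring_scope.

(** * The elimination process as a recursion on the survivor's label *)

Section survivor.
Local Open Scope nat_scope.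

(** The first choice of [c] is the first stab; the remaining ones drive the
    process with one participant fewer, whose survivor [t] is labelled from the
    new holder and in the direction of the stab. *)
Fixpoint survivor (c : seq bool) : nat :=
  if c is same :: c' then
    let t := survivor c' in
    if same then (t + 2) %% (size c').+2 else size c' - t
  else 0.

Lemma survivor_lt c : survivor c < (size c).+1.
Proof.
by elim: c => //= b c IH; case: b; [rewrite ltn_mod | rewrite ltnS leqW ?leq_subr].
Qed.

(** A state is represented here by the list of the participants still alive in
    the order in which the knife meets them: starting with the holder and read
    in the direction of the last stab.  In this form a stab is equivariant under
    relabelling ([turn_stab_map]), which is what makes a recursion possible. *)
Definition turn_stab (b : bool) (l : seq nat) : seq nat :=
  if l is h :: r then
    if (if b then r else rev r) is _ :: r' then rcons r' h else l
  else l.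

Lemma turn_stab_map (f : nat -> nat) b l :
  turn_stab b (map f l) = map f (turn_stab b l).
Proof.
case: l => //= h r; rewrite -map_rev.
by case: b; [case: r => [|v r'] /= | case: (rev r) => [|v r'] /=]; rewrite ?map_rcons.
Qed.

Lemma size_turn_stab b l :
  size (turn_stab b l) = if l is [:: _, _ & _] then (size l).-1 else size l.
Proof.
case: l => //= h [|v r]; first by case: b.
case: b => /=; first by rewrite size_rcons.
have := size_rev (v :: r); case: (rev (v :: r)) => //= v' r' [e].
by rewrite size_rcons e.
Qed.

Lemma nth_turn_stab b m i : i < m.+1 ->
  nth 0 (turn_stab b (iota 0 m.+2)) i = if b then (i + 2) %% m.+2 else m - i.
Proof.
move=> im; case: b => /=.
  rewrite nth_rcons size_iota; case: ltnP => im'.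
    by rewrite nth_iota// modn_small; lia.
  have -> : i = m by lia.
  by rewrite eqxx addn2 modnn.
rewrite -[1 :: iota 2 m]/(iota 1 m.+1) -[m.+1]addn1 iotaD rev_cat /=.
rewrite nth_rcons size_rev size_iota; case: ltnP => im'.
  by rewrite nth_rev size_iota// nth_iota; lia.
have -> : i = m by lia.
by rewrite eqxx subnn.
Qed.

Lemma foldl_turn_stab_map (f : nat -> nat) c l :
  foldl (fun l b => turn_stab b l) (map f l) c =
  map f (foldl (fun l b => turn_stab b l) l c).
Proof. by elim: c l => //= b c IH l; rewrite turn_stab_map IH. Qed.

(** After the first stab the list is a relabelling of [iota 0 (size c).+1], so
    the survivor is read off from the smaller process through that relabelling. *)
Lemma foldl_turn_stab c :
  foldl (fun l b => turn_stab b l) (iota 0 (size c).+1) c = [:: survivor c].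
Proof.
elim: c => // b c IH.
rewrite -[LHS]/(foldl (fun l b => turn_stab b l)
  (turn_stab b (iota 0 (size c).+2)) c).
set l := turn_stab b _.
have sl : size l = (size c).+1 by rewrite /l size_turn_stab/= size_iota.
rewrite -(mkseq_nth 0 l) sl /mkseq foldl_turn_stab_map IH /=.
by rewrite nth_turn_stab// survivor_lt.
Qed.

Definition oriented (d : bool) (l : seq nat) := if d then l else rev l.

(** [alive] is only determined up to rotation by the turn order, since a stab
    does not move the origin of the list of survivors. *)
Definition turn_order (s : state) (l : seq nat) : Prop :=
  [/\ uniq l, l = holder s :: behead l &
      exists k, alive s = rot k (oriented (dir s) l)].

Lemma filter_rot (a : pred nat) k s :
  exists k', seq.filter a (rot k s) = rot k' (seq.filter a s).
Proof.
exists (size (seq.filter a (take k s))).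
by rewrite -{3}(cat_take_drop k s) filter_cat rot_size_cat -filter_cat.
Qed.

Lemma rot_rot_ex k1 k2 (s : seq nat) : exists k, rot k1 (rot k2 s) = rot k s.
Proof.
case: (leqP k2 (size s)) => h2; last by exists k1; rewrite (rot_oversize (ltnW h2)).
case: (leqP k1 (size s)) => h1; last by exists k2; rewrite rot_oversize// size_rot ltnW.
by exists (if k1 + k2 <= size s then k1 + k2 else k1 + k2 - size s); rewrite rot_add_mod.
Qed.

Lemma rot_rotr_ex k (s : seq nat) : exists k', rot k s = rot k' (rot 1 s).
Proof.
have -> : rot k s = rot k (rot (size s).-1 (rot 1 s)).
  by rewrite -subn1 -[size s](size_rot 1) -/(rotr 1 _) rotK.
by have [k' ->] := rot_rot_ex k (size s).-1 (rot 1 s); exists k'.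
Qed.

(** Stabbing in the opposite direction amounts to reversing the turn order
    behind the holder and then stabbing in the same direction. *)
Lemma turn_order_flip s l : turn_order s l ->
  turn_order (State (alive s) (holder s) (~~ dir s)) (holder s :: rev (behead l)).
Proof.
case=> ul El [k Ek]; split => //=.
  by move: ul; rewrite {1}El !cons_uniq mem_rev rev_uniq.
rewrite {}Ek El /= /oriented; case: (dir s) => /=.
- set h := holder s; set r := behead l.
  by rewrite rev_cons revK -rot1_cons; exact: rot_rotr_ex.
- rewrite rev_cons -rot1_cons.
  exact: rot_rot_ex.
Qed.

Lemma turn_order_step s h v r : turn_order s [:: h, v & r] ->
  turn_order (stab s true) (rcons r h).
Proof.
case: s => al h' d [ul [/= eh] [k /= Ek]]; subst h'.
set l := [:: h, v & r] in ul Ek.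
have ual : uniq al by rewrite Ek rot_uniq /oriented; case: d {Ek}; rewrite ?rev_uniq.
have nb x : neighbour d al x = next l x.
  rewrite Ek /neighbour /oriented; case: d {Ek} => /=.
    by rewrite next_rot.
  by rewrite prev_rot ?rev_uniq// prev_rev.
have hv : next l h = v by rewrite /l /= eqxx.
have hne : h != v by move: ul; rewrite /= inE negb_or; case/andP=> /andP[].
have vr : next l v = head h r.
  rewrite /l /= [v == h]eq_sym (negPf hne).
  by case: (r) => [|w r'] /=; rewrite eqxx.
rewrite /stab /= !nb hv vr; split => /=.
- rewrite rcons_uniq; move: ul; rewrite /= inE negb_or => /and3P[/andP[_ ->]].
  by rewrite /=; move=> _ ->.
- by case: (r).
rewrite rem_filter// Ek.
have [k' ->] := filter_rot (predC1 v) k (oriented d l).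
have -> : seq.filter (predC1 v) (oriented d l) = oriented d (h :: r).
  have El : seq.filter (predC1 v) l = h :: r.
    rewrite /l /= hne /= eqxx /=; congr cons.
    apply/all_filterP/allP => x xr; apply/negP => /eqP xv.
    by move: ul; rewrite /= -xv xr /= andbF.
  by rewrite /oriented; case: d {nb ual Ek} => //; rewrite filter_rev El.
rewrite /oriented; case: d {nb ual Ek}.
  have [k1 ->] := rot_rotr_ex k' (h :: r).
  by rewrite rot1_cons; exists k1.
rewrite rev_rcons rev_cons -rot1_cons.
exact: rot_rot_ex.
Qed.

Lemma turn_order_stab s l b : turn_order s l -> 1 < size l ->
  turn_order (stab s b) (turn_stab b l).
Proof.
move=> sl; case: b.
  by case: l sl => [|h [|v r]] sl l1 //; apply: turn_order_step sl.
move=> l1; have sl' := turn_order_flip sl.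
have -> : stab s false = stab (State (alive s) (holder s) (~~ dir s)) true by [].
case: l sl sl' l1 => [|h r] // [_ [<-] _] sl'.
rewrite [size _]/= -size_rev ltnS /= in sl' * .
by case: (rev r) sl' => // v r' sl' _; exact: (turn_order_step sl').
Qed.

Lemma turn_order_foldl c s l : turn_order s l -> size c < size l ->
  turn_order (foldl stab s c) (foldl (fun l b => turn_stab b l) l c).
Proof.
elim: c s l => //= b c IH s l sl cl; apply: IH.
  by apply: turn_order_stab => //; lia.
by rewrite size_turn_stab; case: l sl cl => [|h [|v r]] //=; lia.
Qed.

Lemma survivesE N (c : N.+1.-1.-tuple bool) n : survives (N := N.+1) c n = (n == survivor c).
Proof.
rewrite /survives.
have : turn_order (foldl stab (initial_state N.+1) c) [:: survivor c].
  rewrite -foldl_turn_stab size_tuple.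
  apply: turn_order_foldl; last by rewrite size_iota size_tuple.
  split => //=; first exact: (iota_uniq 0 N.+1).
  by exists 0; rewrite rot0.
case=> _ _ [k ->].
have -> : oriented (dir (foldl stab (initial_state N.+1) c)) [:: survivor c] = [:: survivor c].
  by rewrite /oriented; case: dir.
have -> : rot k [:: survivor c] = [:: survivor c] by case: k => // k; rewrite rot_oversize.
by rewrite eqseq_cons andbT eq_sym.
Qed.

End survivor.

(** * Moments of the survivor's label *)

Section moments.
Variables (R : realType) (p : R).

Definition mean (N : nat) (phi : nat -> R) : R :=
  \sum_(n < N) survival_prob p N n * phi n.

Local Notation weight c := (\prod_(same <- c) (if same then p else 1 - p)).

(** Summing over the label of the survivor and over the choices commute, since
    each sequence of choices has exactly one survivor. *)
Lemma mean_tuple N (phi : nat -> R) :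
  mean N.+1 phi = \sum_(c : N.-tuple bool) weight c * phi (survivor c).
Proof.
rewrite /mean /survival_prob.
under eq_bigr do rewrite big_distrl/=.
under eq_bigr do rewrite big_mkcond/=.
rewrite exchange_big/=; apply: eq_bigr => c _.
have lt : (survivor c < N.+1)%N by have := survivor_lt c; rewrite size_tuple.
rewrite -big_mkcond/= (big_pred1 (Ordinal lt))// => i.
by rewrite survivesE.
Qed.

Lemma big_tuple_cons (V : zmodType) m (F : m.+1.-tuple bool -> V) :
  \sum_c F c = \sum_(c : m.-tuple bool) F [tuple of true :: c] +
               \sum_(c : m.-tuple bool) F [tuple of false :: c].
Proof.
rewrite (reindex (fun bc : bool * m.-tuple bool => [tuple of bc.1 :: bc.2]))/=.
  by rewrite -(pair_bigA _ (fun b (c : m.-tuple bool) => F [tuple of b :: c]))/= big_bool.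
exists (fun c => (thead c, behead_tuple c)) => [[b c] _|c _] /=.
  by rewrite theadE; congr pair; apply: val_inj.
by rewrite [in RHS](tuple_eta c); apply: val_inj.
Qed.

Lemma mean1 phi : mean 1 phi = phi 0%N.
Proof.
rewrite mean_tuple (big_pred1 [tuple]) ?big_nil ?mul1r// => c; apply/esym/eqP.
exact: tuple0.
Qed.

Lemma mean_rec m phi : mean m.+2 phi =
  p * mean m.+1 (fun t => phi ((t + 2) %% m.+2)%N) +
  (1 - p) * mean m.+1 (fun t => phi (m - t)%N).
Proof.
rewrite !mean_tuple big_tuple_cons !big_distrr /=.
by congr (_ + _); apply: eq_bigr => c _; rewrite big_cons/= size_tuple mulrA.
Qed.

Lemma eq_mean N phi psi : (forall n, (n < N)%N -> phi n = psi n) -> mean N phi = mean N psi.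
Proof. by move=> e; apply: eq_bigr => i _; rewrite e. Qed.

Lemma meanD N phi psi : mean N (fun n => phi n + psi n) = mean N phi + mean N psi.
Proof. by rewrite -big_split; apply: eq_bigr => i _; rewrite mulrDr. Qed.

Lemma meanZ N a phi : mean N (fun n => a * phi n) = a * mean N phi.
Proof. by rewrite big_distrr; apply: eq_bigr => i _; rewrite mulrCA. Qed.

Lemma mean_cst N a : mean N.+1 (fun=> a) = a.
Proof.
elim: N => [|N IH]; first by rewrite mean1.
by rewrite mean_rec !IH; ring.
Qed.

Lemma mean_delta N k : (k < N)%N -> mean N (fun n => (n == k)%:R) = survival_prob p N k.
Proof.
move=> kN; rewrite /mean (bigD1 (Ordinal kN))//= eqxx mulr1 big1 ?addr0// => i.
by rewrite -(inj_eq val_inj)/= => /negPf ->; rewrite mulr0.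
Qed.

Hypothesis p01 : 0 < p < 1.

Lemma survival_prob_ge0 N n : 0 <= survival_prob p N n.
Proof.
case/andP: p01 => p0 p1.
rewrite /survival_prob sumr_ge0// => c _; rewrite prodr_ge0// => b _.
by case: b; lra.
Qed.

Lemma le_mean N phi psi : (forall n, (n < N)%N -> phi n <= psi n) -> mean N phi <= mean N psi.
Proof.
by move=> h; apply: ler_sum => i _; rewrite ler_wpM2l ?h// survival_prob_ge0.
Qed.

(** Both moves send the last label to 0, and no other label. *)
Lemma last_mean m : survival_prob p m.+2 0 = survival_prob p m.+1 m.
Proof.
rewrite -!mean_delta// mean_rec.
rewrite (@eq_mean _ (fun t => ((t + 2) %% m.+2 == 0)%N%:R) (fun t => (t == m)%:R)); last first.
  move=> t tm; congr (nat_of_bool _)%:R; case: (ltnP t m) => h.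
    by rewrite modn_small; lia.
  have -> : t = m by lia.
  by rewrite addn2 modnn !eqxx.
rewrite (@eq_mean _ (fun t => (m - t == 0)%N%:R) (fun t => (t == m)%:R)); last first.
  by move=> t tm; congr (nat_of_bool _)%:R; lia.
ring.
Qed.

(** The deviation from the antipode of the first holder, in number of places. *)
Definition offset (N n : nat) : R := n%:R - N%:R / 2.

Lemma offset_right m t : (t < m.+1)%N ->
  offset m.+2 ((t + 2) %% m.+2) = offset m.+1 t + 3 / 2 - m.+2%:R * (t == m)%:R.
Proof.
move=> tm; rewrite /offset; case: eqP => [->|/eqP h].
  by rewrite addn2 modnn -(addn2 m) -(addn1 m) !natrD /=; lra.
rewrite modn_small; last by lia.
by rewrite -(addn2 m) -(addn1 m) !natrD /=; lra.
Qed.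

Lemma offset_left m t : (t < m.+1)%N ->
  offset m.+2 (m - t) = - (offset m.+1 t + 3 / 2).
Proof.
move=> tm; rewrite /offset natrB; last by lia.
by rewrite -(addn2 m) -(addn1 m) !natrD; lra.
Qed.

Lemma mean_offset_rec m : mean m.+2 (offset m.+2) =
  (2 * p - 1) * (mean m.+1 (offset m.+1) + 3 / 2) -
  p * m.+2%:R * survival_prob p m.+2 0.
Proof.
rewrite mean_rec last_mean -mean_delta//.
rewrite (eq_mean (psi := fun t => (offset m.+1 t + 3 / 2) + (- m.+2%:R) * (t == m)%:R)); last first.
  by move=> t tm; rewrite offset_right// mulNr.
rewrite (@eq_mean _ (fun t => offset _ (m - t)) (fun t => (-1) * (offset m.+1 t + 3 / 2))); last first.
  by move=> t tm; rewrite offset_left// mulN1r.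
rewrite meanD !meanZ (meanD _ (offset m.+1)) mean_cst; ring.
Qed.

(** At the wrap-around, N / 2 becomes - N / 2, which has the same square: the
    second moment satisfies an exact recursion without boundary term. *)
Lemma mean_sqr_offset_rec m : mean m.+2 (fun n => offset m.+2 n ^+ 2) =
  mean m.+1 (fun n => offset m.+1 n ^+ 2) + 3 * mean m.+1 (offset m.+1) + 9 / 4.
Proof.
rewrite mean_rec.
set psi := fun t => offset m.+1 t ^+ 2 + (3 * offset m.+1 t + 9 / 4).
rewrite (eq_mean (psi := psi)); last first.
  move=> t tm; rewrite offset_right// /psi; case: eqP => [->|_].
    by rewrite /offset -(addn2 m) -(addn1 m) !natrD /=; field.
  by rewrite /=; field.
rewrite (@eq_mean _ (fun t => offset _ (m - t) ^+ 2) psi); last first.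
  by move=> t tm; rewrite offset_left// /psi; field.
by rewrite -mulrDl addrC subrK mul1r /psi 2!meanD meanZ mean_cst addrA.
Qed.

(** Near the first holder, the number of places that separate the survivor from
    him grows by 2 on his right and decreases by 1 on his left, and the side
    persists with probability p.  With q = 1 - p, the function
    lam^S + 5/4 lam^(N - S), where lam = 1 - 3 q / 16, contracts in mean: the
    factor 5/4 penalizes the unfavourable side enough to make up for the
    persistence, and being larger than 1 it also makes the wrap-around from N to
    0 favourable. *)
Lemma edge_decay : exists C rho : R, [/\ 0 < C, 0 < rho < 1 &
  forall m, survival_prob p m.+1 0 <= C * rho ^+ m].
Proof.
case/andP: (p01) => p0 p1.
pose q := 1 - p; pose lam := 1 - 3 / 16 * q; pose y : R := 5 / 4.
have q01 : 0 < q < 1 by rewrite /q; lra.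
have lam01 : 0 < lam < 1 by rewrite /lam; lra.
pose a := lam ^+ 2 * (p + q * y); pose b := (q + p * y) / (lam * y).
have ly : 0 < lam * y by rewrite /y; lra.
have a01 : 0 < a < 1.
  rewrite /a /lam; have -> : p + q * y = 1 + q / 4 by rewrite /y /q; field.
  apply/andP; split; nra.
have b01 : 0 < b < 1.
  rewrite /b divr_gt0 ?ltr_pdivrMr// ?mul1r; rewrite /lam /y /q; lra.
pose rho := Num.max a b.
have r01 : 0 < rho < 1 by rewrite /rho /Num.max; case: ifP.
have l0 k : 0 <= lam ^+ k by rewrite exprn_ge0//; lra.
pose W m := mean m.+1 (fun n => lam ^+ n + y * lam ^+ (m.+1 - n)).
have Wrec m : W m.+1 <= rho * W m.
  rewrite /W mean_rec -!meanZ -meanD; apply: le_mean => t tm.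
  set e := lam ^+ t; set f := lam ^+ (m - t).
  have -> : (m.+2 - (m - t) = t.+2)%N by clear -tm; lia.
  have -> : (m.+1 - t = (m - t).+1)%N by clear -tm; lia.
  have h1 : lam ^+ ((t + 2) %% m.+2) + y * lam ^+ (m.+2 - (t + 2) %% m.+2) <=
      lam ^+ 2 * e + y * f.
    rewrite /e /f; case: (ltnP t m) => tm'.
      rewrite modn_small; last by clear -tm'; lia.
      by rewrite exprD mulrC; have -> : (m.+2 - (t + 2) = m - t)%N by clear; lia.
    have -> : t = m by clear -tm tm'; lia.
    rewrite addn2 modnn subn0 subnn -exprD add2n expr0.
    have : lam ^+ m.+2 <= 1 by rewrite exprn_ile1//; lra.
    have := l0 m.+2; rewrite /y; nra.
  rewrite -/f !exprS -/e -/f.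
  have -> : lam * (lam * e) = lam ^+ 2 * e by ring.
  have ha : a <= rho by rewrite le_max lexx.
  have hb : q + p * y <= rho * (lam * y).
    by rewrite -ler_pdivrMr// le_max lexx orbT.
  have e0 := l0 t; have f0 := l0 (m - t)%N; rewrite -/e -/f in e0 f0.
  apply: (@le_trans _ _ (a * e + (q + p * y) * f)).
    have := ler_wpM2l (ltW p0) h1.
    by rewrite /a /q; nra.
  have := ler_wpM2r e0 ha; have := ler_wpM2r f0 hb; nra.
have W0 : W 0%N <= 9 / 4.
  by rewrite /W mean1 expr0 subn0 expr1 /y; lra.
have Wm m : W m <= 9 / 4 * rho ^+ m.
  elim: m => [|m IH]; first by rewrite expr0 mulr1.
  apply: (le_trans (Wrec m)); rewrite exprS mulrCA ler_wpM2l//; lra.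
exists (9 / 4), rho; split => // m; apply: le_trans (Wm m).
rewrite -mean_delta//; apply: le_mean => n nm.
case: eqP => [->|_]; rewrite ?expr0 ?lerDl ?addr_ge0// mulr_ge0// /y; lra.
Qed.

Lemma natr_expr_bound (r : R) n : 0 <= r -> r < 1 -> n%:R * r ^+ n <= (1 - r)^-1.
Proof.
move=> r0 r1; have r1' : 0 < 1 - r by lra.
rewrite -[leRHS]mul1r ler_pdivlMr//.
suff : n%:R * r ^+ n * (1 - r) + r ^+ n <= 1.
  by have := exprn_ge0 n r0; lra.
elim: n => [|n IH]; first by rewrite mul0r mul0r add0r expr0.
rewrite exprS -addn1 natrD.
have rn1 : r * r ^+ n <= 1 by rewrite -exprS exprn_ile1// ltW.
have := ler_wpM2l (ltW r1') rn1; have := ler_wpM2l r0 IH.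
by move: (r ^+ n) => s; lra.
Qed.

Lemma sum_natr_expr_bound (r : R) n : 0 <= r -> r < 1 ->
  \sum_(k < n) k%:R * r ^+ k <= (1 - r) ^- 2.
Proof.
move=> r0 r1; have r1' : 0 < 1 - r by lra.
rewrite -[leRHS]mul1r ler_pdivlMr ?exprn_gt0//.
suff -> : (\sum_(k < n) k%:R * r ^+ k) * (1 - r) ^+ 2 =
    r - r ^+ n * (n%:R * (1 - r) + r).
  have : 0 <= r ^+ n * (n%:R * (1 - r) + r).
    by rewrite mulr_ge0 ?exprn_ge0// addr_ge0// mulr_ge0// ltW.
  lra.
elim: n => [|n IH]; first by rewrite big_ord0 expr0; lra.
rewrite big_ord_recr/= mulrDl IH (exprS r n) -(addn1 n) natrD; ring.
Qed.

(** The recursion for the mean is a contraction with ratio |2 p - 1| < 1, and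
    its error term N P(S_N = 0) is bounded because of the geometric decay. *)
Lemma mean_offset_bounded : exists2 K : R, 0 <= K &
  forall N, `|mean N.+1 (offset N.+1)| <= K.
Proof.
case/andP: (p01) => p0 p1.
have [C [rho [C0 /andP[rho0 rho1] gC]]] := edge_decay.
pose r := `|2 * p - 1|.
have r0 : 0 <= r by exact: normr_ge0.
have r1 : r < 1 by rewrite /r ltr_norml; lra.
pose K0 := C * ((1 - rho)^-1 + 1).
have K00 : 0 <= K0 by rewrite mulr_ge0 ?addr_ge0 ?invr_ge0//; lra.
pose K := (3 / 2 + K0) / (1 - r).
have rK : r * K + (3 / 2 + K0) = K by rewrite /K; field; lra.
have K1 : 3 / 2 <= K.
  by rewrite /K ler_pdivlMr; nra.
exists K => [|N]; first by lra.
elim: N => [|m IH].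
  rewrite mean1 /offset sub0r normrN ger0_norm; lra.
rewrite mean_offset_rec; apply: le_trans (ler_normB _ _) _.
rewrite normrM -/r -{}rK.
have h1 : `|mean m.+1 (offset m.+1) + 3 / 2| <= K + 3 / 2.
  by apply: le_trans (ler_normD _ _) _; rewrite (ger0_norm (x := 3 / 2)) ?lerD2r//; lra.
have h2 : `|p * m.+2%:R * survival_prob p m.+2 0| <= K0.
  rewrite ger0_norm; last by rewrite !mulr_ge0 ?survival_prob_ge0// ltW.
  have := gC m.+1; set g := survival_prob _ _ _ => gm.
  have g0 : 0 <= g by exact: survival_prob_ge0.
  have n1 := natr_expr_bound m.+1 (ltW rho0) rho1.
  have n2 : rho ^+ m.+1 <= 1 by rewrite exprn_ile1// ltW.
  apply: (@le_trans _ _ (m.+2%:R * (C * rho ^+ m.+1))).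
    rewrite -mulrA -[leRHS]mul1r ler_pM ?mulr_ge0//; first exact: ltW.
      exact: ltW.
    by rewrite ler_wpM2l.
  rewrite mulrCA /K0 ler_wpM2l//; first exact: ltW.
  by rewrite -(addn1 m.+1) natrD mulrDl mul1r lerD.
have := ler_wpM2l r0 h1; nra.
Qed.

Lemma mean_sqr_offset_le : exists2 K : R, 0 <= K &
  forall N, mean N.+1 (fun n => offset N.+1 n ^+ 2) <= K * N.+1%:R.
Proof.
have [K K0 hK] := mean_offset_bounded.
exists (3 * K + 9 / 4) => [|N]; first by lra.
elim: N => [|m IH].
  by rewrite mean1 /offset; nra.
rewrite mean_sqr_offset_rec -(addn1 m.+1) natrD mulrDr mulr1.
have := hK m; rewrite ler_norml => /andP[_ h]; lra.
Qed.

Hypothesis p12 : p = 1 / 2.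

(** For p = 1 / 2 the linear part of the recursion vanishes; only the
    geometrically small error term is left. *)
Lemma sum_mean_offset_bounded : exists2 K : R, 0 <= K &
  forall n, \sum_(N < n) `|mean N.+1 (offset N.+1)| <= K.
Proof.
case/andP: (p01) => p0 p1.
have [C [rho [C0 /andP[rho0 rho1] gC]]] := edge_decay.
have bound N : `|mean N.+1 (offset N.+1)| <= (N == 0)%:R + C * (N%:R * rho ^+ N).
  case: N => [|m].
    rewrite mean1 mul0r mulr0 eqxx /offset sub0r normrN ger0_norm /=; lra.
  rewrite mean_offset_rec {1}p12.
  have -> : 2 * (1 / 2) - 1 = 0 :> R by field.
  rewrite mul0r sub0r normrN ger0_norm; last first.
    by rewrite !mulr_ge0 ?survival_prob_ge0//; lra.
  rewrite add0r.
  have := gC m.+1; set g := survival_prob _ _ _ => gm.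
  rewrite mulrCA; apply: ler_pM => //; rewrite ?mulr_ge0 ?survival_prob_ge0//; first by lra.
  by rewrite p12 -(addn1 m.+1) natrD -(addn1 m) natrD; have := ler0n R m; lra.
exists (1 + C * (1 - rho) ^- 2) => [|n].
  by rewrite addr_ge0// mulr_ge0 ?invr_ge0 ?exprn_ge0//; lra.
apply: le_trans (ler_sum _ (fun (N : 'I_n) _ => bound N)) _.
rewrite big_split/= lerD//.
  case: n => [|n]; first by rewrite big_ord0.
  by rewrite big_ord_recl/= big1 ?addr0.
by rewrite -big_distrr/= ler_wpM2l ?sum_natr_expr_bound// ltW.
Qed.

Lemma mean_sqr_offset_near : exists2 K : R, 0 <= K &
  forall N, `|mean N.+1 (fun n => offset N.+1 n ^+ 2) - 9 / 4 * N.+1%:R| <= K.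
Proof.
have [K K0 hK] := sum_mean_offset_bounded.
exists (2 + 3 * K) => [|N]; first by lra.
suff h : `|mean N.+1 (fun n => offset N.+1 n ^+ 2) - 9 / 4 * N.+1%:R| <=
    2 + 3 * \sum_(k < N) `|mean k.+1 (offset k.+1)|.
  by apply: le_trans h _; rewrite lerD2l ler_wpM2l.
elim: N => [|m IH].
  by rewrite mean1 /offset big_ord0 ler_norml; lra.
rewrite mean_sqr_offset_rec big_ord_recr/= -(addn1 m.+1) natrD.
move: IH; rewrite !ler_norml.
have := ler_norm (mean m.+1 (offset m.+1)).
have := ler_norm (- mean m.+1 (offset m.+1)); rewrite normrN.
move: (mean m.+1 (offset m.+1)) => x h1 h2 /andP[h3 h4]; apply/andP; split; lra.
Qed.

End moments.

(** * Taylor bounds *)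

Section taylor.
Variable R : realType.
Implicit Types (f df : R -> R) (a b x h t K M : R).

Lemma mean_value_bound f df a b K :
  (forall x, Num.min a b <= x <= Num.max a b -> is_derive x 1 f (df x)) ->
  (forall x, `|x - a| <= `|b - a| -> Num.min a b <= x <= Num.max a b ->
     `|df x| <= K) ->
  `|f b - f a| <= K * `|b - a|.
Proof.
wlog ab : a b / a <= b => [th fd dK|fd dK].
  have [ab|/ltW ba] := leP a b; first exact: th.
  rewrite distrC (distrC b); apply: th => //.
    by move=> x xab; apply: fd; rewrite minC maxC.
  move=> x _ xab; apply: dK; last by rewrite minC maxC.
  move: xab; rewrite min_l// max_r// => /andP[bx xa].
  by rewrite distrC (distrC b) !ger0_norm ?subr_ge0// lerB.
rewrite min_l// max_r// in fd dK.
have fd' x : x \in `[a, b] -> is_derive x 1 f (df x).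
  by rewrite in_itv/=; exact: fd.
have [|c] := MVT_segment ab (fun x xab => fd' x (subset_itv_oo_cc xab)).
  by apply: derivable_within_continuous => x /fd' h; exact: ex_derive.
rewrite in_itv/= => cab ->; rewrite normrM ler_wpM2r// dK//.
by case/andP: cab => ac cb; rewrite !ger0_norm ?subr_ge0// lerB.
Qed.

Lemma taylor2_bound f (f1 f2 f3 : R -> R) M x h :
  (forall x, is_derive x 1 f (f1 x)) -> (forall x, is_derive x 1 f1 (f2 x)) ->
  (forall x, is_derive x 1 f2 (f3 x)) -> (forall x, `|f3 x| <= M) ->
  `|f (x + h) - (f x + h * f1 x + h ^+ 2 / 2 * f2 x)| <= M * `|h| ^+ 3.
Proof.
move=> d1 d2 d3 fM.
have step2 u : `|f2 u - f2 x| <= M * `|u - x|.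
  by apply: (mean_value_bound (df := f3)).
have step1 u : `|u - x| <= `|h| -> `|f1 u - f1 x - (u - x) * f2 x| <= M * `|h| ^+ 2.
  move=> uh.
  pose g u := f1 u - f1 x - (u - x) * f2 x.
  have gx : g x = 0 by rewrite /g; ring.
  rewrite -/(g u) -[g u]subr0 -gx.
  apply: (le_trans (mean_value_bound (df := fun u => f2 u - f2 x) (K := M * `|h|) _ _)).
  - by move=> v _; rewrite /g; apply: is_derive_eq; rewrite !scaler0 /GRing.scale/=; ring.
  - move=> v vu _; apply: (le_trans (step2 v)); rewrite ler_wpM2l//.
      by apply: le_trans (fM x).
    exact: le_trans uh.
  - rewrite expr2 mulrA ler_wpM2l// mulr_ge0//.
    by apply: le_trans (fM x).
pose g u := f u - f x - (u - x) * f1 x - (u - x) ^+ 2 / 2 * f2 x.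
have gx : g x = 0 by rewrite /g; ring.
have -> : f (x + h) - (f x + h * f1 x + h ^+ 2 / 2 * f2 x) = g (x + h) - g x.
  by rewrite gx /g; ring.
apply: (le_trans (mean_value_bound (K := M * `|h| ^+ 2)
  (df := fun u => f1 u - f1 x - (u - x) * f2 x) _ _)).
- move=> v _; rewrite /g; apply: is_derive_eq.
  by rewrite !scaler0 /GRing.scale/=; field.
- by move=> v; rewrite (addrC x) addrK => vh _; exact: step1.
- by rewrite (addrC x) addrK -mulrA -exprSr.
Qed.

Lemma taylor1_bound f (f1 f2 : R -> R) M t s : 0 <= s ->
  (forall x, t <= x <= t + s -> is_derive x 1 f (f1 x)) ->
  (forall x, t <= x <= t + s -> is_derive x 1 f1 (f2 x)) ->
  (forall x, t <= x <= t + s -> `|f2 x| <= M) ->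
  `|f (t + s) - (f t + s * f1 t)| <= M * s ^+ 2.
Proof.
move=> s0 d1 d2 fM.
have step1 u : t <= u <= t + s -> `|f1 u - f1 t| <= M * s.
  case/andP=> tu us.
  have M0 : 0 <= M by apply: le_trans (fM t _) => //; rewrite lexx lerDl.
  apply: (@le_trans _ _ (M * `|u - t|)).
    apply: (mean_value_bound (df := f2)) => v.
      by rewrite min_l// max_r// => /andP[tv vu]; apply: d2; rewrite tv (le_trans vu).
    move=> _; rewrite min_l// max_r// => /andP[tv vu].
    by apply: fM; rewrite tv (le_trans vu).
  by rewrite ler_wpM2l// ger0_norm ?subr_ge0// lerBlDl.
pose g u := f u - f t - (u - t) * f1 t.
have gt : g t = 0 by rewrite /g; ring.
have -> : f (t + s) - (f t + s * f1 t) = g (t + s) - g t.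
  by rewrite gt /g; ring.
have ts : t <= t + s by rewrite lerDl.
apply: (le_trans (mean_value_bound (K := M * s)
  (df := fun u => f1 u - f1 t) _ _)).
- move=> v; rewrite min_l// max_r// => /d1 h; rewrite /g; apply: is_derive_eq.
  by rewrite !scaler0 /GRing.scale/=; ring.
- by move=> v _; rewrite min_l// max_r// => vh; exact: step1.
- by rewrite (addrC t) addrK -mulrA (ger0_norm s0).
Qed.

End taylor.

(** * The heat kernel *)

Section kernel.
Variable R : realType.

(** The heat kernel t^(-1/2) exp(- x^2 / (2 t)), without its factor
    (2 pi)^(-1/2); writing the power of t as an exponential keeps all its
    derivatives of the form polynomial in x and t^-1 times the kernel. *)
Definition kernel (t x : R) : R := expR (- (x ^+ 2 / 2 * t^-1) - ln t / 2).

Definition kernel_x (t x : R) : R := - (x * t^-1) * kernel t x.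
Definition kernel_xx (t x : R) : R := (x ^+ 2 * t^-1 ^+ 2 - t^-1) * kernel t x.
Definition kernel_xxx (t x : R) : R :=
  (3 * x * t^-1 ^+ 2 - x ^+ 3 * t^-1 ^+ 3) * kernel t x.
Definition kernel_tt (t x : R) : R :=
  (x ^+ 4 * t^-1 ^+ 4 - 6 * x ^+ 2 * t^-1 ^+ 3 + 3 * t^-1 ^+ 2) / 4 * kernel t x.

Lemma is_derive_kernel (t x : R) : is_derive x 1 (kernel t) (kernel_x t x).
Proof.
rewrite /kernel_x /kernel; apply: is_derive_eq.
by rewrite !scaler0 /GRing.scale/=; move: (expR _) => u; move: t^-1 => v; field.
Qed.

Lemma is_derive_kernel_x (t x : R) : is_derive x 1 (kernel_x t) (kernel_xx t x).
Proof.
have dk := is_derive_kernel t x.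
rewrite /kernel_xx /kernel_x; apply: is_derive_eq.
by rewrite /GRing.scale/= /kernel_x; ring.
Qed.

Lemma is_derive_kernel_xx (t x : R) : is_derive x 1 (kernel_xx t) (kernel_xxx t x).
Proof.
have dk := is_derive_kernel t x.
rewrite /kernel_xxx /kernel_xx; apply: is_derive_eq.
by rewrite /GRing.scale/= /kernel_x; ring.
Qed.

Lemma is_derive_inv (t : R) : 0 < t -> is_derive t 1 (fun t : R => t^-1) (- t^-1 ^+ 2).
Proof.
move=> t0; have t1 : (fun t : R => t) t != 0 by rewrite gt_eqF.
apply: (is_derive_eq (is_deriveV t1 (is_derive_id _ _))).
by rewrite /GRing.scale/= mulr1 exprVn.
Qed.

(** The heat equation: the derivative in t is half the second derivative in x. *)
Lemma is_derive_kernel_t (t x : R) : 0 < t ->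
  is_derive t 1 (kernel ^~ x) (kernel_xx t x / 2).
Proof.
move=> t0; have dl := is_derive1_ln t0; have dv := is_derive_inv t0.
rewrite /kernel_xx /kernel; apply: is_derive_eq.
by rewrite !scaler0 /GRing.scale/=; field; rewrite gt_eqF.
Qed.

Lemma is_derive_kernel_xx_t (t x : R) : 0 < t ->
  is_derive t 1 (fun t => kernel_xx t x / 2) (kernel_tt t x).
Proof.
move=> t0; have dv := is_derive_inv t0; have dk := is_derive_kernel_t x t0.
rewrite /kernel_tt /kernel_xx.
apply: is_derive_eq.
by rewrite !scaler0 /GRing.scale/= /kernel_xx; field; rewrite gt_eqF.
Qed.

Lemma kernel_ge0 t x : 0 <= kernel t x.
Proof. exact: expR_ge0. Qed.

Lemma sqr_le_expR (v : R) : 0 <= v -> v ^+ 2 <= 4 * expR v.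
Proof.
move=> v0; have h : 0 <= v / 2 <= expR (v / 2).
  by have := expR_ge1Dx (v / 2); rewrite divr_ge0//=; lra.
have -> : v = v / 2 + v / 2 by lra.
by rewrite expRD; move: (expR (v / 2)) h => E /andP[h1 h2]; nra.
Qed.

Lemma kernel_decay (e t x : R) : 0 < e -> e <= t <= 2 ->
  (1 + x ^+ 4) * kernel t x <= 65 * expR (- ln e / 2).
Proof.
move=> e0 /andP[et t2].
have t0 : 0 < t by exact: lt_le_trans et.
have k1 : kernel t x <= expR (- (x ^+ 2 / 4)) * expR (- ln e / 2).
  rewrite -expRD ler_expR lerD//.
    rewrite lerN2; have -> : x ^+ 2 / 4 = x ^+ 2 / 2 * 2^-1 by field.
    by rewrite ler_wpM2l ?divr_ge0 ?sqr_ge0// lef_pV2 ?posrE.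
  by rewrite -mulNr ler_wpM2r// lerN2 ler_ln.
have x4 : (1 + x ^+ 4) * expR (- (x ^+ 2 / 4)) <= 65.
  rewrite expRN ler_pdivrMr ?expR_gt0//.
  have v0 : 0 <= x ^+ 2 / 4 by rewrite divr_ge0// sqr_ge0.
  have := sqr_le_expR v0; have := expR_ge1Dx (x ^+ 2 / 4).
  have -> : (x ^+ 2 / 4) ^+ 2 = x ^+ 4 / 16 by field.
  move: v0; lra.
have x0 : 0 <= 1 + x ^+ 4 by rewrite addr_ge0// exprn_even_ge0.
apply: le_trans (ler_wpM2l x0 k1) _.
by rewrite mulrA ler_wpM2r ?expR_ge0.
Qed.

(** Each derivative is a sum of terms c x^k t^-j times the kernel with k, j <= 4,
    so that the bound for (1 + x^4) times the kernel covers them all. *)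
Lemma kernel_bound (e : R) : 0 < e <= 1 -> exists2 M : R, 0 <= M &
  forall t x, e <= t <= 2 -> [/\ `|kernel_x t x| <= M, `|kernel_xx t x| <= M,
    `|kernel_xxx t x| <= M & `|kernel_tt t x| <= M].
Proof.
case/andP=> e0 e1; pose A := e^-1; have A1 : 1 <= A by rewrite /A -invr1 lef_pV2 ?posrE.
have A4 : 0 <= A ^+ 4 by rewrite exprn_ge0//; lra.
pose M0 := A ^+ 4 * (65 * expR (- ln e / 2)).
have M00 : 0 <= M0 by apply: mulr_ge0 => //; apply: mulr_ge0 => //; exact: expR_ge0.
exists (4 * M0); first by lra.
move=> t x et.
have t0 : 0 < t by case/andP: et => et _; exact: lt_le_trans et.
have v0 : 0 <= t^-1 by rewrite invr_ge0 ltW.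
have mono k j : (k <= 4)%N -> (j <= 4)%N -> `|x| ^+ k * t^-1 ^+ j * kernel t x <= M0.
  move=> k4 j4.
  have hk : `|x| ^+ k <= 1 + x ^+ 4.
    have -> : x ^+ 4 = `|x| ^+ 4 by rewrite -normrX ger0_norm// exprn_even_ge0.
    have [x1|/ltW x1] := leP `|x| 1.
      by apply: (@le_trans _ _ 1); rewrite ?exprn_ile1// lerDl exprn_ge0.
    by apply: (@le_trans _ _ (`|x| ^+ 4)); rewrite ?ler_weXn2l// lerDr.
  have hj : t^-1 ^+ j <= A ^+ 4.
    apply: (@le_trans _ _ (A ^+ j)); last by rewrite ler_weXn2l.
    rewrite lerXn2r ?nnegrE /A ?invr_ge0 ?(ltW e0) ?(ltW t0)// lef_pV2 ?posrE//.
    by case/andP: et.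
  apply: (@le_trans _ _ ((1 + x ^+ 4) * A ^+ 4 * kernel t x)).
    by rewrite ler_wpM2r ?kernel_ge0// ler_pM// exprn_ge0.
  by rewrite -mulrA mulrCA ler_wpM2l// kernel_decay.
have k0 := kernel_ge0 t x.
have m k j (c : R) : `|c * x ^+ k * t^-1 ^+ j * kernel t x| =
    `|c| * (`|x| ^+ k * t^-1 ^+ j * kernel t x).
  by rewrite !normrM !normrX (ger0_norm v0) (ger0_norm k0) !mulrA.
split.
- have -> : kernel_x t x = (-1) * x ^+ 1 * t^-1 ^+ 1 * kernel t x.
    by rewrite /kernel_x; ring.
  by rewrite m normrN normr1 mul1r; have := @mono 1 1 isT isT; lra.
- have -> : kernel_xx t x = 1 * x ^+ 2 * t^-1 ^+ 2 * kernel t x -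
      1 * x ^+ 0 * t^-1 ^+ 1 * kernel t x by rewrite /kernel_xx; ring.
  apply: le_trans (ler_normB _ _) _; rewrite !m normr1.
  by have := @mono 2 2 isT isT; have := @mono 0 1 isT isT; lra.
- have -> : kernel_xxx t x = 3 * x ^+ 1 * t^-1 ^+ 2 * kernel t x -
      1 * x ^+ 3 * t^-1 ^+ 3 * kernel t x by rewrite /kernel_xxx; ring.
  apply: le_trans (ler_normB _ _) _; rewrite !m normr1 ger0_norm//.
  by have := @mono 1 2 isT isT; have := @mono 3 3 isT isT; lra.
- have -> : kernel_tt t x = 4^-1 * x ^+ 4 * t^-1 ^+ 4 * kernel t x -
      (6 / 4) * x ^+ 2 * t^-1 ^+ 3 * kernel t x +
      3 / 4 * x ^+ 0 * t^-1 ^+ 2 * kernel t x.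
    by rewrite /kernel_tt; move: (kernel t x) (t^-1) => u v; field.
  apply: le_trans (ler_normD _ _) _; apply: le_trans (lerD (ler_normB _ _) (lexx _)) _.
  rewrite !m (ger0_norm (x := 4^-1))//.
  rewrite (ger0_norm (x := 6 / 4)) ?divr_ge0// (ger0_norm (x := 3 / 4)) ?divr_ge0//.
  have := @mono 4 4 isT isT; have := @mono 2 3 isT isT; have := @mono 0 2 isT isT; lra.
Qed.

End kernel.

(** * Lindeberg replacement on the heat kernel *)

Section lindeberg.
Variables (R : realType) (D : pred nat) (m : nat -> nat).
Variables w h : nat -> nat -> R.

Definition avg N (phi : nat -> R) := \sum_(i < m N) w N i * phi i.
Definition moment1 N := avg N (h N).
Definition moment2 N := avg N (fun i => h N i ^+ 2).
Definition spread N := moment2 N - moment1 N ^+ 2.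

(** The operator that sends f to E[f(x + b h)], where h is the random variable
    taking the value [h N i] with probability [w N i]. *)
Definition smear (b : R) (N : nat) (f : R -> R) (x : R) : R :=
  avg N (fun i => f (x + b * h N i)).

Definition smears (b : R) (s : seq nat) (f : R -> R) : R -> R :=
  foldr (smear b) f s.

Hypothesis w_ge0 : forall N i, D N -> (i < m N)%N -> 0 <= w N i.
Hypothesis w_sum1 : forall N, D N -> \sum_(i < m N) w N i = 1.
Hypothesis h_le1 : forall N i, D N -> (i < m N)%N -> `|h N i| <= 1.

Lemma avgD N phi psi : avg N (fun i => phi i + psi i) = avg N phi + avg N psi.
Proof. by rewrite -big_split; apply: eq_bigr => i _; rewrite mulrDr. Qed.

Lemma avgZ N a phi : avg N (fun i => a * phi i) = a * avg N phi.
Proof. by rewrite /avg big_distrr; apply: eq_bigr => i _; rewrite mulrCA. Qed.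

Lemma avg_cst N a : D N -> avg N (fun=> a) = a.
Proof. by move=> DN; rewrite /avg -big_distrl/= w_sum1// mul1r. Qed.

Lemma le_avg N phi psi : D N -> (forall i, (i < m N)%N -> phi i <= psi i) ->
  avg N phi <= avg N psi.
Proof. by move=> DN h'; apply: ler_sum => i _; rewrite ler_wpM2l ?h' ?w_ge0. Qed.

Lemma norm_avg_le N phi : D N -> `|avg N phi| <= avg N (fun i => `|phi i|).
Proof.
move=> DN; apply: le_trans (ler_norm_sum _ _ _) _; apply: ler_sum => i _.
by rewrite normrM ger0_norm ?w_ge0.
Qed.

Lemma moments_le1 N : D N ->
  [/\ `|moment1 N| <= 1, 0 <= spread N & spread N <= 1].
Proof.
move=> DN.
have m1 : `|moment1 N| <= 1.
  apply: le_trans (norm_avg_le _ DN) _; rewrite -[leRHS](avg_cst _ DN).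
  by apply: le_avg => // i iN; exact: h_le1.
split => //.
  have : 0 <= avg N (fun i => (h N i - moment1 N) ^+ 2).
    by rewrite -(avg_cst 0 DN); apply: le_avg => // i _; exact: sqr_ge0.
  have -> : (fun i => (h N i - moment1 N) ^+ 2) =
      (fun i => h N i ^+ 2 + ((- 2 * moment1 N) * h N i + moment1 N ^+ 2)).
    by apply/funext => i; ring.
  rewrite 2!avgD avgZ avg_cst// -/(moment1 N) -/(moment2 N) /spread; nra.
rewrite /spread lerBlDr; apply: (@le_trans _ _ 1); last by rewrite lerDl sqr_ge0.
rewrite -[leRHS](avg_cst _ DN); apply: le_avg => // i iN.
by rewrite -real_normK ?num_real// exprn_ile1// h_le1.
Qed.

Lemma smear_contraction b N f g d x : D N ->
  (forall x, `|f x - g x| <= d) -> `|smear b N f x - smear b N g x| <= d.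
Proof.
move=> DN fg; rewrite /smear.
have -> : avg N (fun i => f (x + b * h N i)) - avg N (fun i => g (x + b * h N i)) =
    avg N (fun i => f (x + b * h N i) - g (x + b * h N i)).
  rewrite avgD; congr (_ + _); rewrite -mulN1r -avgZ.
  by apply: eq_bigr => i _; rewrite mulN1r.
apply: le_trans (norm_avg_le _ DN) _; rewrite -[leRHS](avg_cst _ DN).
by apply: le_avg => // i iN; exact: fg.
Qed.

Section kernel_steps.
Variables (e M : R).
Hypothesis e01 : 0 < e <= 1.
Hypothesis M_ge0 : 0 <= M.
Hypothesis kM : forall t x, e <= t <= 2 ->
  [/\ `|kernel_x t x| <= M, `|kernel_xx t x| <= M,
    `|kernel_xxx t x| <= M & `|kernel_tt t x| <= M].

Definition step_error b N := 3 * b * `|moment1 N| + 2 * b ^+ 3 * spread N.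

(** Expanding the average in x to the second order and the kernel in t to the
    first order, the second-order terms cancel by the heat equation; the
    remainders are those of Taylor's formula and of the nonzero mean. *)
Lemma smear_kernel b N t x : D N -> 0 <= b <= 1 -> e <= t ->
  t + b ^+ 2 * spread N <= 2 ->
  `|smear b N (kernel t) x - kernel (t + b ^+ 2 * spread N) x| <= M * step_error b N.
Proof.
move=> DN /andP[b0 b1] et t2.
have [m1 v0 v1] := moments_le1 DN.
have s0 : 0 <= b ^+ 2 * spread N by rewrite mulr_ge0// sqr_ge0.
have et2 : e <= t <= 2 by rewrite et (le_trans _ t2)// lerDl.
set s := b ^+ 2 * spread N in s0 t2 *.
have e0 : 0 < e by case/andP: e01.
have R2 : `|kernel (t + s) x - (kernel t x + s * (kernel_xx t x / 2))| <= M * s ^+ 2.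
  have := @taylor1_bound R (fun t => kernel t x) (fun t => kernel_xx t x / 2)
    (fun t => kernel_tt t x) M t s s0; apply => u /andP[tu us].
  - by apply: is_derive_kernel_t; apply: lt_le_trans (le_trans et tu).
  - by apply: is_derive_kernel_xx_t; apply: lt_le_trans (le_trans et tu).
  - have [|_ _ _] // := kM (t := u) x.
    by rewrite (le_trans et tu)/= (le_trans us t2).
pose rest i := kernel t (x + b * h N i) -
  (kernel t x + b * h N i * kernel_x t x + (b * h N i) ^+ 2 / 2 * kernel_xx t x).
have R1 : `|avg N rest| <= M * b ^+ 3 * moment2 N.
  apply: le_trans (norm_avg_le _ DN) _; rewrite -avgZ; apply: le_avg => // i iN.
  apply: (@le_trans _ _ (M * `|b * h N i| ^+ 3)).
    apply: (taylor2_bound _ _ (is_derive_kernel t) (is_derive_kernel_x t) (is_derive_kernel_xx t)).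
    by move=> y; have [] := kM y et2.
  rewrite -mulrA ler_wpM2l// normrM exprMn (ger0_norm b0) ler_wpM2l ?exprn_ge0//.
  rewrite -[leRHS]real_normK ?num_real// exprSr ler_piMr ?sqr_ge0 ?h_le1//.
have E : smear b N (kernel t) x = kernel t x + b * moment1 N * kernel_x t x +
    b ^+ 2 * moment2 N / 2 * kernel_xx t x + avg N rest.
  rewrite /smear /moment1 /moment2.
  have -> : (fun i => kernel t (x + b * h N i)) = (fun i => kernel t x +
      ((b * kernel_x t x) * h N i + ((b ^+ 2 / 2 * kernel_xx t x) * h N i ^+ 2 + rest i))).
    by apply/funext => i; rewrite /rest; field.
  by rewrite 3!avgD 2!avgZ avg_cst//; field.
have [kx kxx _ _] := kM x et2.
have -> : smear b N (kernel t) x - kernel (t + s) x =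
    b * moment1 N * kernel_x t x + b ^+ 2 * moment1 N ^+ 2 / 2 * kernel_xx t x +
    avg N rest - (kernel (t + s) x - (kernel t x + s * (kernel_xx t x / 2))).
  by rewrite E /s /spread; field.
apply: le_trans (ler_normB _ _) _.
apply: le_trans (lerD (ler_normD _ _) R2) _.
apply: le_trans (lerD (lerD (ler_normD _ _) R1) (lexx _)) _.
have -> : `|b * moment1 N * kernel_x t x| = b * `|moment1 N| * `|kernel_x t x|.
  by rewrite !normrM (ger0_norm b0).
have -> : `|b ^+ 2 * moment1 N ^+ 2 / 2 * kernel_xx t x| =
    b ^+ 2 * moment1 N ^+ 2 / 2 * `|kernel_xx t x|.
  by rewrite normrM ger0_norm// divr_ge0// mulr_ge0// sqr_ge0.
rewrite /step_error.
have q1 : moment1 N ^+ 2 <= `|moment1 N|.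
  by rewrite -real_normK ?num_real// expr2 ler_piMl.
have vE : moment2 N = spread N + moment1 N ^+ 2 by rewrite /spread subrK.
have b2 : b ^+ 2 <= b by rewrite expr2 ler_piMl.
have b3 : b ^+ 3 <= b by rewrite exprS ler_piMr// exprn_ile1.
have b30 : 0 <= b ^+ 3 by rewrite exprn_ge0.
have n0 : 0 <= `|moment1 N| by [].
have mq : 0 <= moment1 N ^+ 2 by exact: sqr_ge0.
have bq : b ^+ 2 * moment1 N ^+ 2 <= b * `|moment1 N| by rewrite ler_pM ?sqr_ge0.
have b3q : b ^+ 3 * moment1 N ^+ 2 <= b * `|moment1 N| by rewrite ler_pM.
have t1 : b * `|moment1 N| * `|kernel_x t x| <= M * (b * `|moment1 N|).
  by rewrite mulrC ler_wpM2r// mulr_ge0.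
have t2' : b ^+ 2 * moment1 N ^+ 2 / 2 * `|kernel_xx t x| <= M * (b * `|moment1 N|).
  rewrite mulrC; apply: ler_pM => //; first by rewrite divr_ge0// mulr_ge0// sqr_ge0.
  have := mulr_ge0 b0 n0; lra.
have t3 : M * b ^+ 3 * moment2 N <= M * (b ^+ 3 * spread N + b * `|moment1 N|).
  by rewrite -mulrA ler_wpM2l// vE mulrDr lerD2l.
have t4 : M * s ^+ 2 <= M * (b ^+ 3 * spread N).
  have b4 : (b ^+ 2) ^+ 2 <= b ^+ 3 by rewrite -exprM (exprSr b 3) ler_piMr.
  have v2 : spread N ^+ 2 <= spread N by rewrite expr2 ler_piMr.
  by rewrite ler_wpM2l// /s exprMn ler_pM ?exprn_ge0.
lra.
Qed.

(** One variable is replaced at a time, the averaging operators being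
    contractions for the uniform norm. *)
Lemma smears_kernel b s t x : all D s -> 0 <= b <= 1 -> e <= t ->
  t + b ^+ 2 * (\sum_(N <- s) spread N) <= 2 ->
  `|smears b s (kernel t) x - kernel (t + b ^+ 2 * (\sum_(N <- s) spread N)) x| <=
    M * \sum_(N <- s) step_error b N.
Proof.
elim: s x => [|N s IH] x /=.
  by rewrite !big_nil !mulr0 addr0 subrr normr0.
case/andP=> DN Ds b01 et; rewrite !big_cons => t2.
have [_ v0 _] := moments_le1 DN.
have b20 : 0 <= b ^+ 2 * spread N by rewrite mulr_ge0// sqr_ge0.
set S := \sum_(N <- s) spread N in IH t2 *.
have S0 : 0 <= b ^+ 2 * S.
  rewrite mulr_ge0 ?sqr_ge0// /S big_seq sumr_ge0// => j js.
  by have [] := moments_le1 (allP Ds j js).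
have -> : t + b ^+ 2 * (spread N + S) = (t + b ^+ 2 * S) + b ^+ 2 * spread N by ring.
rewrite [leRHS]mulrDr [leRHS]addrC.
apply: le_trans (ler_distD (smear b N (kernel (t + b ^+ 2 * S)) x) _ _) (lerD _ _).
  by apply: smear_contraction => // y; apply: IH => //; lra.
by apply: smear_kernel => //; lra.
Qed.

End kernel_steps.
End lindeberg.


(** * Convolution with the heat kernel *)

Section gaussian_smoothing.
Variable R : realType.
Notation mu := (@lebesgue_measure R).
Local Notation itg g := (mu.-integrable setT (EFin \o g)).
Implicit Types (f g : R -> R).

Lemma itg_measurable g : itg g -> measurable_fun [set: R] g.
Proof. by move=> /measurable_int /measurable_EFinP. Qed.

Lemma itg_dominated g h : measurable_fun [set: R] g -> (forall x, `|g x| <= h x) ->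
  itg h -> itg g.
Proof.
move=> mg gh; apply: le_integrable => //; first exact/measurable_EFinP.
by move=> x _ /=; rewrite lee_fin (le_trans (gh x))// ler_norm.
Qed.

Lemma itgZ c g : itg g -> itg (fun x => c * g x).
Proof. by move=> /(@integrableZl _ _ _ _ _ measurableT c); apply: eq_integrable. Qed.

Lemma itgD g h : itg g -> itg h -> itg (fun x => g x + h x).
Proof. by move=> ig ih; have := integrableD measurableT ig ih; apply: eq_integrable. Qed.

Lemma itgB g h : itg g -> itg h -> itg (fun x => g x - h x).
Proof. by move=> ig ih; have := integrableB measurableT ig ih; apply: eq_integrable. Qed.

Lemma itg_sum n (F : nat -> R -> R) : (forall i, (i < n)%N -> itg (F i)) ->
  itg (fun x => \sum_(i < n) F i x) /\
  \int[mu]_x (\sum_(i < n) F i x) = \sum_(i < n) \int[mu]_x F i x.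
Proof.
elim: n => [_|n IH hF].
  split; first by under eq_fun do rewrite big_ord0; exact: integrable0.
  rewrite big_ord0; under eq_Rintegral do rewrite big_ord0.
  by rewrite Rintegral_cst// mul0r.
have [iS eS] := IH (fun i h => hF i (ltnW h)).
have En : (fun x => \sum_(i < n.+1) F i x) = (fun x => \sum_(i < n) F i x + F n x).
  by apply/funext => x; rewrite big_ord_recr.
rewrite En big_ord_recr/=; split; first by apply: itgD => //; exact: hF.
by rewrite RintegralD ?eS//; exact: hF.
Qed.

Definition normalizer : R := (Num.sqrt (pi *+ 2))^-1.

Lemma normalizer_ge0 : 0 <= normalizer.
Proof. by rewrite invr_ge0. Qed.

Lemma normal_pdf_kernel (t x y : R) : 0 < t ->
  normal_pdf x (Num.sqrt t) y = normalizer * kernel t (y - x).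
Proof.
move=> t0; have s0 : Num.sqrt t != 0 by rewrite gt_eqF// sqrtr_gt0.
rewrite normal_pdfE//= /normal_peak /normal_fun sqr_sqrtr ?(ltW t0)//.
rewrite -mulrnAr sqrtrM ?(ltW t0)// invfM /kernel expRD.
have -> : expR (- (ln t / 2)) = (Num.sqrt t)^-1.
  rewrite expRN; congr (_^-1); apply/eqP.
  rewrite -(eqrXn2 (n := 2)) ?expR_ge0 ?sqrtr_ge0//.
  by rewrite sqr_sqrtr ?(ltW t0)// -expRM_natl mulrCA divff ?mulr1 ?lnK.
have -> : - (y - x) ^+ 2 / (t *+ 2) = - ((y - x) ^+ 2 / 2 / t).
  by rewrite -mulr_natr; field; rewrite gt_eqF.
by rewrite /normalizer; ring.
Qed.

Lemma normal_pdf_itg (m s : R) : itg (normal_pdf m s).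
Proof. exact: integrable_normal_pdf. Qed.

Lemma kernel_itg (t x : R) : 0 < t -> itg (fun y : R => kernel t (y - x)).
Proof.
move=> t0; have n0 : normalizer != 0.
  by rewrite invr_neq0// gt_eqF// sqrtr_gt0 pmulrn_lgt0// pi_gt0.
apply: eq_integrable (itgZ normalizer^-1 (normal_pdf_itg x (Num.sqrt t))) => // y _ /=.
by rewrite normal_pdf_kernel// mulrA mulVf// mul1r.
Qed.

Lemma Rintegral_kernel (t x : R) : 0 < t ->
  normalizer * \int[mu]_y (kernel t (y - x)) = 1.
Proof.
move=> t0; rewrite -RintegralZl//; last exact: kernel_itg.
under eq_Rintegral do rewrite -normal_pdf_kernel//.
by rewrite /Rintegral integral_normal_pdf.
Qed.

Lemma measurable_kernel (t x : R) : 0 < t -> measurable_fun [set: R] (fun y : R => kernel t (y - x)).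
Proof. by move=> /(@kernel_itg t x) /itg_measurable. Qed.

Lemma bounded_kernel_itg f M (t x : R) : measurable_fun [set: R] f -> 0 < t ->
  (forall y, `|f y| <= M) -> itg (fun y : R => f y * kernel t (y - x)).
Proof.
move=> mf t0 fM; apply: itg_dominated (itgZ M (kernel_itg x t0)).
  by apply: measurable_funM => //; exact: measurable_kernel.
by move=> y; rewrite normrM (ger0_norm (kernel_ge0 _ _)) ler_wpM2r ?kernel_ge0.
Qed.

(** Trading half of the Gaussian exponent for a small factor leaves the kernel
    at twice the time, whose integral is known: this bounds Gaussian tails
    uniformly in the center without computing any moment. *)
Lemma kernel_tail (e d u : R) : 0 < e -> 0 < d -> d <= `|u| ->
  kernel e u <= 8 * e / d ^+ 2 * kernel (2 * e) u.
Proof.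
move=> e0 d0 du.
have d2 : d ^+ 2 <= u ^+ 2.
  by rewrite -[leRHS]real_normK ?num_real// lerXn2r ?nnegrE ?(ltW d0).
have -> : kernel e u = expR (- (u ^+ 2 / (4 * e))) * expR (ln 2 / 2) * kernel (2 * e) u.
  rewrite /kernel -!expRD; congr expR.
  by rewrite lnM ?posrE//; field; rewrite gt_eqF.
rewrite ler_wpM2r ?kernel_ge0//.
have h1 : expR (- (u ^+ 2 / (4 * e))) <= 4 * e / d ^+ 2.
  rewrite expRN -[4 * e / d ^+ 2]invrK invf_div lef_pV2 ?posrE ?expR_gt0//; last first.
    by rewrite divr_gt0 ?exprn_gt0// mulr_gt0.
  apply: (@le_trans _ _ (u ^+ 2 / (4 * e))).
    by rewrite ler_pM2r// invr_gt0 mulr_gt0.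
  by apply: le_trans (expR_ge1Dx _); rewrite lerDr.
have h2 : expR (ln 2 / 2) <= 2 :> R.
  have l2 : 0 <= ln 2 :> R by rewrite ln_ge0// ler1n.
  by rewrite -[leRHS]lnK ?posrE// ler_expR; lra.
have -> : 8 * e / d ^+ 2 = 4 * e / d ^+ 2 * 2 by field; rewrite gt_eqF.
by rewrite ler_pM ?expR_ge0.
Qed.

Definition smooth (t : R) f (x : R) : R :=
  normalizer * \int[mu]_y (f y * kernel t (y - x)).

Lemma smooth_cst t c x : 0 < t -> smooth t (cst c) x = c.
Proof.
move=> t0; rewrite /smooth RintegralZl//; last exact: kernel_itg.
by rewrite mulrCA Rintegral_kernel// mulr1.
Qed.

Lemma smoothB t f g M x : measurable_fun [set: R] f -> measurable_fun [set: R] g -> 0 < t ->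
  (forall y, `|f y| <= M) -> (forall y, `|g y| <= M) ->
  smooth t f x - smooth t g x = smooth t (fun y => f y - g y) x.
Proof.
move=> mf mg t0 fM gM; rewrite /smooth -mulrBr -RintegralB//; last 2 first.
- exact: bounded_kernel_itg fM.
- exact: bounded_kernel_itg gM.
by congr (_ * _); apply: eq_Rintegral => y _; rewrite mulrBl.
Qed.

Lemma norm_smooth_le t f h M x : measurable_fun [set: R] f -> 0 < t ->
  (forall y, `|f y| <= M) -> itg h ->
  (forall y, `|f y| * kernel t (y - x) <= h y) ->
  `|smooth t f x| <= normalizer * \int[mu]_y h y.
Proof.
move=> mf t0 fM ih fh; rewrite /smooth normrM (ger0_norm normalizer_ge0).
rewrite ler_wpM2l ?normalizer_ge0//.
have ifk := bounded_kernel_itg x mf t0 fM.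
apply: le_trans (le_normr_Rintegral measurableT ifk) _.
have fkE y : `|f y * kernel t (y - x)| = `|f y| * kernel t (y - x).
  by rewrite normrM (ger0_norm (kernel_ge0 _ _)).
apply: le_Rintegral => // [|y _]; last by rewrite fkE.
apply: (itg_dominated _ _ ih).
  by apply: measurableT_comp => //; exact: itg_measurable ifk.
by move=> y; rewrite normr_id fkE.
Qed.

(** Within distance d of the center f varies by at most eta; beyond, the tail
    bound applies. *)
Lemma smooth_close t f M eta d x : measurable_fun [set: R] f -> 0 < t -> 0 < d ->
  0 <= eta -> (forall y, `|f y| <= M) -> (forall x y, `|y - x| < d -> `|f y - f x| <= eta) ->
  `|smooth t f x - f x| <= eta + 16 * M * t / d ^+ 2.
Proof.
move=> mf t0 d0 eta0 fM fd.
have M0 : 0 <= M by apply: le_trans (fM 0).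
rewrite -[X in _ - X](smooth_cst (f x) x t0).
rewrite (smoothB _ _ _ t0 fM (fun _ => fM x))//.
have t20 : 0 < 2 * t by rewrite mulr_gt0.
(* The factor of kernel_tail at distance d, times the bound of |f y - f x|. *)
pose c := 2 * M * (8 * t / d ^+ 2).
have c0 : 0 <= c by rewrite !mulr_ge0 ?invr_ge0 ?exprn_ge0 ?(ltW d0) ?(ltW t0).
pose h y := eta * kernel t (y - x) + c * kernel (2 * t) (y - x).
have ih : itg h by apply: itgD; apply: itgZ; exact: kernel_itg.
apply: le_trans (norm_smooth_le (M := 2 * M) (h := h) _ t0 _ ih _) _.
- exact: measurable_funB.
- by move=> y; apply: le_trans (ler_normB _ _) _; have := fM y; have := fM x; rewrite /cst; lra.
- move=> y; rewrite /h /cst; have k0 := kernel_ge0 t (y - x).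
  have k20 := kernel_ge0 (2 * t) (y - x).
  have [yx|yx] := ltP `|y - x| d.
    apply: (@le_trans _ _ (eta * kernel t (y - x))); first by rewrite ler_wpM2r// fd.
    by rewrite lerDl mulr_ge0.
  apply: (@le_trans _ _ (c * kernel (2 * t) (y - x))); last by rewrite lerDr mulr_ge0.
  rewrite /c -mulrA; apply: ler_pM => //; last exact: kernel_tail.
  by apply: le_trans (ler_normB _ _) _; have := fM y; have := fM x; lra.
rewrite /h RintegralD//; [|exact/itgZ/kernel_itg|exact/itgZ/kernel_itg].
rewrite !RintegralZl//; [|exact: kernel_itg|exact: kernel_itg].
rewrite mulrDr (mulrCA normalizer eta) (mulrCA normalizer c).
rewrite (Rintegral_kernel x t0) (Rintegral_kernel x t20) !mulr1 lerD2l /c.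
by rewrite le_eqVlt; apply/orP; left; apply/eqP; field; rewrite gt_eqF.
Qed.

(** The replacement started at time e ends at time 1 + e; this brings it back to
    time 1. *)
Lemma kernel_time : exists2 M : R, 0 <= M &
  forall e u, 0 <= e <= 1 -> `|kernel (1 + e) u - kernel 1 u| <= M * e.
Proof.
have [|M M0 kM] := @kernel_bound R 1; first by rewrite ltr01 lexx.
exists M => // e u /andP[e0 e1].
have le1 : 1 <= 1 + e by rewrite lerDl.
have -> : M * e = M * `|1 + e - 1| by rewrite (addrC 1) addrK ger0_norm.
have := @mean_value_bound R (fun t => kernel t u) (fun t => kernel_xx t u / 2) 1 (1 + e) M.
rewrite (min_l le1) (max_r le1); apply=> v => [/andP[v1 _]|_ /andP[v1 v2]].
  by apply: is_derive_kernel_t; exact: lt_le_trans v1.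
have [|_ kx _ _] := kM v u; first by rewrite v1/= (le_trans v2)// -[leRHS]/(1 + 1) lerD2l.
by rewrite normrM (ger0_norm (x := 2^-1))//; have := normr_ge0 (kernel_xx v u); lra.
Qed.

Lemma Rintegral_compact_le f g M K d : 0 <= K -> (forall y, `|f y| <= M) ->
  (forall y, K < `|y| -> f y = 0) -> (forall y, `|g y| <= d) ->
  itg (fun y => f y * g y) ->
  `|\int[mu]_y (f y * g y)| <= 2 * K * (M * d).
Proof.
move=> K0 fM fK gd ifg.
have M0 : 0 <= M by apply: le_trans (fM 0).
have d0 : 0 <= d by apply: le_trans (gd 0).
apply: le_trans (le_normr_Rintegral measurableT ifg) _.
pose I : set R := `[- K, K]%classic.
have mI : measurable I by exact: measurable_itv.
have muI : mu I = (2 * K)%:E.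
  rewrite /I lebesgue_measure_itv/= lte_fin; case: ltP => h.
    by rewrite -EFinD; congr EFin; ring.
  by congr EFin; lra.
have iI : itg (\1_I : R -> R).
  apply/integrableP; split; first by apply/measurable_EFinP; apply: measurable_indic.
  under eq_integral do rewrite /= ger0_norm//.
  by rewrite integral_indic//= setIT muI ltry.
have eI : \int[mu]_y (\1_I y : R) = 2 * K.
  by rewrite /Rintegral integral_indic//= setIT muI.
rewrite mulrC -eI -RintegralZl//; apply: le_Rintegral => //.
- apply: (itg_dominated _ _ (itgZ (M * d) iI)).
    by apply: measurableT_comp => //; exact: itg_measurable ifg.
  move=> y; rewrite normr_id normrM indicE; case: (boolP (y \in I)) => [_|] /=.
    by rewrite mulr1 ler_pM.
  rewrite notin_setE /I/= in_itv/= -ler_norml => /negP; rewrite -ltNge => /fK ->.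
  by rewrite normr0 mul0r mulr0.
- exact: itgZ.
- move=> y _; rewrite normrM indicE; case: (boolP (y \in I)) => [_|] /=.
    by rewrite mulr1 ler_pM.
  rewrite notin_setE /I/= in_itv/= -ler_norml => /negP; rewrite -ltNge => /fK ->.
  by rewrite normr0 mul0r mulr0.
Qed.

End gaussian_smoothing.


(** * Uniform continuity and cutoffs *)

Section uniform_continuity.
Variable R : realType.

(** Heine's theorem on [- K, K], the point y being unrestricted; if neither x nor
    y lies in that interval, f vanishes at both. *)
Lemma compact_support_uniformly_continuous (f : R -> R) (K eta : R) :
  continuous f -> (forall x, K < `|x| -> f x = 0) -> 0 < eta ->
  exists2 d : R, 0 < d & forall x y, `|y - x| < d -> `|f y - f x| <= eta.
Proof.
move=> cf fK eta0; pose I : set R := `[- K, K]%classic.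
have cI : compact I by exact: segment_compact.
have [d /= d0 hd] : \forall d \near (0 : R)^'+, I `<=` (fun x => forall y, `|y - x| < d -> `|f y - f x| <= eta).
  move/compact_near_coveringP : cI; apply => x _.
  have /cvgrPdist_lt /(_ (eta / 2)) := cf x.
  rewrite divr_gt0// => /(_ isT) [r /= r0 hr].
  exists (ball x (r / 2), [set d | d < r / 2]).
    split; first by apply: nbhsx_ballx; rewrite divr_gt0.
    by apply: nbhs_right_lt; rewrite divr_gt0.
  move=> [x' d] /= [xx' dr] y yd.
  have h1 := hr x' _; have h2 := hr y _.
  have {}h1 : `|f x - f x'| < eta / 2.
    by apply: h1; rewrite /ball_/=; apply: lt_trans xx' _; lra.
  have {}h2 : `|f x - f y| < eta / 2.
    apply: h2; rewrite /ball_/= -(subrK x' x) -addrA.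
    apply: le_lt_trans (ler_normD _ _) _; rewrite (distrC x').
    by rewrite /ball/= in xx'; lra.
  rewrite -(subrK (f x) (f y)) -addrA; apply: le_trans (ler_normD _ _) _.
  by rewrite (distrC (f y)); lra.
exists (d / 2); first by rewrite divr_gt0.
have d20 : 0 < d / 2 by rewrite divr_gt0.
have hI := hd (d / 2) _ d20; rewrite /ball_/= sub0r normrN gtr0_norm// in hI.
have {}hI : I `<=` (fun x => forall y, `|y - x| < d / 2 -> `|f y - f x| <= eta).
  by apply: hI; lra.
move=> x y xy.
have zero z : ~ I z -> f z = 0.
  by rewrite /I/= in_itv/= -ler_norml => /negP; rewrite -ltNge => /fK.
have [Ix|/zero fx] := pselect (I x); first exact: hI.
have [Iy|/zero fy] := pselect (I y); last by rewrite fx fy subrr normr0 ltW.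
by rewrite distrC; apply: hI => //; rewrite distrC.
Qed.

Definition cutoff (k x : R) : R := Num.max 0 (Num.min 1 (k + 1 - `|x|)).

Lemma continuous_cutoff k : continuous (cutoff k).
Proof.
move=> x; rewrite /cutoff.
apply: (@continuous_max _ _ (cst 0) (fun x => Num.min 1 (k + 1 - `|x|))); first exact: cvg_cst.
apply: (@continuous_min _ _ (cst 1) (fun x => k + 1 - `|x|)); first exact: cvg_cst.
by apply: cvgB; [exact: cvg_cst|exact: norm_continuous].
Qed.

Lemma cutoff_ge0 k x : 0 <= cutoff k x.
Proof. by rewrite le_max lexx. Qed.

Lemma cutoff_le1 k x : cutoff k x <= 1.
Proof. by rewrite /cutoff ge_max ler01 ge_min lexx. Qed.

Lemma cutoff_in k x : `|x| <= k -> cutoff k x = 1.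
Proof. by move=> h; rewrite /cutoff min_l ?max_r//; lra. Qed.

Lemma cutoff_out k x : k + 1 < `|x| -> cutoff k x = 0.
Proof. by move=> h; rewrite /cutoff max_l// ge_min; apply/orP; right; lra. Qed.

End uniform_continuity.

(** * From the heat kernel to bounded continuous functions *)

Section lindeberg_limit.
Variables (R : realType) (D : pred nat) (m : nat -> nat).
Variables w h : nat -> nat -> R.
Hypothesis w_ge0 : forall N i, D N -> (i < m N)%N -> 0 <= w N i.
Hypothesis w_sum1 : forall N, D N -> \sum_(i < m N) w N i = 1.
Hypothesis h_le1 : forall N i, D N -> (i < m N)%N -> `|h N i| <= 1.
Local Notation mu := (@lebesgue_measure R).
Local Notation itg g := (mu.-integrable setT (EFin \o g)).
Local Notation smears := (smears m w h).
Local Notation spread := (spread m w h).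
Local Notation step_error := (step_error m w h).
Implicit Types f g : R -> R.

Lemma smears_cons b N s f x : smears b (N :: s) f x =
  \sum_(i < m N) w N i * smears b s f (x + b * h N i).
Proof. by []. Qed.

Lemma smears_norm_le b s f g x : all D s -> (forall x, `|f x| <= g x) ->
  `|smears b s f x| <= smears b s g x.
Proof.
move=> + fg; elim: s x => [|N s IH] x //= /andP[DN Ds].
apply: le_trans (norm_avg_le w_ge0 _ DN) _.
by apply: (le_avg w_ge0) => // i _; exact: IH.
Qed.

Lemma smearsB b s f g x :
  smears b s (fun z => f z - g z) x = smears b s f x - smears b s g x.
Proof.
elim: s x => [|N s IH] x //=; rewrite /smear /avg -sumrB; apply: eq_bigr => i _.
by rewrite IH mulrBr.
Qed.

Lemma smearsZ b s c f x : smears b s (fun z => c * f z) x = c * smears b s f x.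
Proof.
elim: s x => [|N s IH] x //=; rewrite /smear -avgZ; apply: eq_bigr => i _.
by rewrite IH.
Qed.

Lemma smears_cst b s c x : all D s -> smears b s (cst c) x = c.
Proof.
elim: s x => [|N s IH] x //= /andP[DN Ds].
rewrite /smear -[RHS](avg_cst w_sum1 c DN); apply: eq_bigr => i _.
by rewrite IH.
Qed.

Lemma smears_contraction b s f g d x : all D s -> (forall x, `|f x - g x| <= d) ->
  `|smears b s f x - smears b s g x| <= d.
Proof.
move=> Ds fg; rewrite -smearsB -(smears_cst b d x Ds).
exact: smears_norm_le.
Qed.

Lemma kernelN (t u : R) : kernel t (- u) = kernel t u.
Proof. by rewrite /kernel sqrrN. Qed.

(** Averaging operators commute with the integral in y; what remains under the
    integral is their effect on the heat kernel centered at y. *)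
Lemma smears_smooth b s t f M x : measurable_fun [set: R] f -> 0 < t ->
  (forall y, `|f y| <= M) ->
  itg (fun y : R => f y * smears b s (kernel t) (x - y)) /\
  smears b s (smooth t f) x =
    normalizer R * \int[mu]_y (f y * smears b s (kernel t) (x - y)).
Proof.
move=> mf t0 fM; elim: s x => [|N s IH] x.
  have E : (fun y : R => f y * kernel t (x - y)) = (fun y : R => f y * kernel t (y - x)).
    by apply/funext => y; rewrite -(kernelN t (x - y)) opprB.
  by rewrite /= /smooth E; split => //; exact: bounded_kernel_itg fM.
pose F i y := w N i * (f y * smears b s (kernel t) (x + b * h N i - y)).
have E : (fun y : R => f y * smears b (N :: s) (kernel t) (x - y)) =
    (fun y : R => \sum_(i < m N) F i y).
  apply/funext => y; rewrite smears_cons big_distrr; apply: eq_bigr => i _ /=.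
  by rewrite /F mulrCA addrAC.
have iF i : itg (F i) by apply: itgZ; have [] := IH (x + b * h N i).
have [iS eS] := @itg_sum R (m N) F (fun i _ => iF i).
rewrite E; split => //; rewrite eS smears_cons big_distrr; apply: eq_bigr => i _.
have [ii ->] := IH (x + b * h N i).
by rewrite /F RintegralZl// mulrCA.
Qed.

(** The time e of the smoothing is chosen first, so as to make f close to its
    smoothing and the kernels at times 1 + e and 1 close to each other; the
    constant C then depends on e through the bounds on the derivatives of the
    kernel. *)
Lemma lindeberg_compact_support f M K eta :
  continuous f -> (forall y, `|f y| <= M) -> 0 <= K -> (forall x, K < `|x| -> f x = 0) ->
  0 < eta -> exists2 C : R, 0 <= C & forall b s, all D s -> 0 <= b <= 1 ->
    b ^+ 2 * (\sum_(N <- s) spread N) = 1 ->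
    `|smears b s f 0 - smooth 1 f 0| <= eta + C * \sum_(N <- s) step_error b N.
Proof.
move=> cf fM K0 fK eta0.
have mf : measurable_fun [set: R] f by exact: continuous_measurable_fun.
have M0 : 0 <= M by apply: le_trans (fM 0).
have eta4 : 0 < eta / 4 by rewrite divr_gt0.
have [d d0 fd] := compact_support_uniformly_continuous cf fK eta4.
have [M1 M10 kt] := kernel_time R.
have n0 := normalizer_ge0 R; set n := normalizer R in n0.
pose A := 16 * M / d ^+ 2 + n * (2 * K * (M * M1)) + 1.
have A1 : 0 <= 16 * M / d ^+ 2 by rewrite !mulr_ge0 ?invr_ge0 ?exprn_ge0 ?(ltW d0).
have A2 : 0 <= n * (2 * K * (M * M1)) by rewrite !mulr_ge0.
have A0 : 0 < A by rewrite /A; lra.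
(* A bounds the two errors that are proportional to e. *)
pose e := Num.min 1 (eta / 4 / A).
have e0 : 0 < e by rewrite lt_min ltr01 divr_gt0.
have e1 : e <= 1 by rewrite ge_min lexx.
have eA : A * e <= eta / 4.
  rewrite -(ler_pdivlMl _ _ A0) mulrC; first by rewrite ge_min lexx orbT.
have [|Mk Mk0 kM] := @kernel_bound R e; first by rewrite e0.
exists (n * (2 * K * (M * Mk))) => [|b s Ds b01 b1]; first by rewrite !mulr_ge0.
set S := \sum_(N <- s) step_error b N.
have close x : `|f x - smooth e f x| <= eta / 4 + 16 * M * e / d ^+ 2.
  by rewrite distrC; apply: smooth_close (ltW eta4) fM fd.
have h1 := smears_contraction b 0 Ds close.
have [i1 E1] := smears_smooth b s 0 mf e0 fM.
have i2 := bounded_kernel_itg 0 mf (ltr01 : 0 < 1 :> R) fM.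
pose g y := smears b s (kernel e) (0 - y) - kernel 1 (y - 0).
have gE : (fun y : R => f y * g y) =
    (fun y : R => f y * smears b s (kernel e) (0 - y) - f y * kernel 1 (y - 0)).
  by apply/funext => y; rewrite -mulrBr.
have gd y : `|g y| <= Mk * S + M1 * e.
  have := smears_kernel w_ge0 w_sum1 h_le1 (e := e) (M := Mk) _ Mk0 kM (t := e)
    (0 - y) Ds b01 (lexx e).
  rewrite b1 e0 e1 => /(_ isT) /(_ _).
  have e12 : e + 1 <= 2 by rewrite -[leRHS]/(1 + 1) lerD2r.
  move=> /(_ e12) hk.
  have := kt e (y - 0); rewrite (ltW e0) e1 => /(_ isT) ht.
  apply: le_trans (ler_distD (kernel (e + 1) (0 - y)) _ _) (lerD hk _).
  by rewrite sub0r kernelN (addrC e) subr0; rewrite subr0 in ht.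
have h2 : `|n * \int[mu]_y (f y * g y)| <= n * (2 * K * (M * (Mk * S + M1 * e))).
  rewrite normrM (ger0_norm n0) ler_wpM2l//.
  apply: Rintegral_compact_le => //.
  by rewrite gE; exact: (itgB i1 i2).
have E2 : n * \int[mu]_y (f y * g y) = smears b s (smooth e f) 0 - smooth 1 f 0.
  by rewrite E1 /smooth -mulrBr -RintegralB// -gE.
apply: le_trans (ler_distD (smears b s (smooth e f) 0) _ _) (le_trans (lerD h1 _) _).
  by rewrite -E2; exact: h2.
have -> : 16 * M * e / d ^+ 2 = 16 * M / d ^+ 2 * e by rewrite mulrAC.
have -> : n * (2 * K * (M * (Mk * S + M1 * e))) =
  n * (2 * K * (M * Mk)) * S + n * (2 * K * (M * M1)) * e by ring.
have : 16 * M / d ^+ 2 * e + n * (2 * K * (M * M1)) * e <= eta / 4.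
  by apply: le_trans eA; rewrite /A !mulrDl; lra.
move: eta4; lra.
Qed.

Lemma smooth_tail f M (k : R) : measurable_fun [set: R] f -> 0 < k ->
  (forall y, `|f y| <= M) -> (forall y, `|y| <= k -> f y = 0) ->
  `|smooth 1 f 0| <= 8 * M / k ^+ 2.
Proof.
move=> mf k0 fM fk.
have M0 : 0 <= M by apply: le_trans (fM 0).
pose c := M * (8 * 1 / k ^+ 2).
have t20 : 0 < 2 * 1 :> R by rewrite mulr_gt0.
have c0 : 0 <= c by rewrite !mulr_ge0 ?invr_ge0 ?exprn_ge0 ?(ltW k0).
apply: le_trans (norm_smooth_le (M := M) (h := fun y => c * kernel (2 * 1) (y - 0)) mf ltr01 fM _ _) _.
- exact/itgZ/kernel_itg.
- move=> y; have [yk|yk] := leP `|y| k.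
    by rewrite fk// normr0 mul0r mulr_ge0// kernel_ge0.
  rewrite /c -mulrA ler_pM ?kernel_ge0// kernel_tail//.
  by rewrite subr0 ltW.
rewrite RintegralZl//; last exact: kernel_itg.
by rewrite mulrCA Rintegral_kernel// mulr1 /c mulr1 mulrA (mulrC M).
Qed.

(** The mass that the averages put outside a large interval is controlled by
    applying the compactly supported case to the cutoff function itself, so that
    no separate tightness argument is needed. *)
Lemma lindeberg_bounded_continuous f M eta :
  continuous f -> (forall y, `|f y| <= M) -> 0 < eta ->
  exists2 C : R, 0 <= C & forall b s, all D s -> 0 <= b <= 1 ->
    b ^+ 2 * (\sum_(N <- s) spread N) = 1 ->
    `|smears b s f 0 - smooth 1 f 0| <= eta + C * \sum_(N <- s) step_error b N.
Proof.
move=> cf fM eta0.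
have mf : measurable_fun [set: R] f by exact: continuous_measurable_fun.
have M0 : 0 <= M by apply: le_trans (fM 0).
have M10 : 0 < 16 * M + 1 by lra.
(* The tail bound 8 M / k^2 is used twice; k is such that both uses together
   cost at most eta / 4. *)
pose k := 1 + (16 * M + 1) * 4 / eta.
have k1 : 1 <= k by rewrite lerDl !mulr_ge0 ?invr_ge0 ?(ltW eta0) ?(ltW M10).
have k0 : 0 < k by exact: lt_le_trans k1.
have tail : 16 * M / k ^+ 2 <= eta / 4.
  rewrite ler_pdivrMr ?exprn_gt0//.
  have : k <= k ^+ 2 by rewrite expr2 ler_peMr// ltW.
  have : eta / 4 * k = eta / 4 + (16 * M + 1) by rewrite /k; field; rewrite gt_eqF.
  have e4 : 0 <= eta / 4 by rewrite divr_ge0// ltW.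
  by move=> h1 /(ler_wpM2l e4); lra.
pose chi := cutoff k; pose fc y := f y * chi y.
have cc : continuous chi by exact: continuous_cutoff.
have mc : measurable_fun [set: R] chi by exact: continuous_measurable_fun.
have chi1 y : `|chi y| <= 1 by rewrite ger0_norm ?cutoff_ge0 ?cutoff_le1.
have cfc : continuous fc by move=> y; apply: cvgM; [exact: cf|exact: cc].
have mfc : measurable_fun [set: R] fc by exact: continuous_measurable_fun.
have fcM y : `|fc y| <= M by rewrite /fc normrM -[M]mulr1 ler_pM.
have k10 : 0 <= k + 1 by lra.
have eta8 : 0 < eta / 4 by rewrite divr_gt0.
have fc_out x : k + 1 < `|x| -> fc x = 0.
  by move=> kx; rewrite /fc /chi cutoff_out ?mulr0.
have [C1 C10 h1] := lindeberg_compact_support cfc fcM k10 fc_out eta8.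
have eta' : 0 < eta / (4 * (M + 1)) by rewrite divr_gt0// mulr_gt0//; lra.
have [C2 C20 h2] := lindeberg_compact_support cc chi1 k10
  (fun x kx => cutoff_out kx) eta'.
exists (C1 + M * C2) => [|b s Ds b01 b1]; first by rewrite addr_ge0 ?mulr_ge0.
have {}h1 := h1 b s Ds b01 b1; have {}h2 := h2 b s Ds b01 b1.
set S := \sum_(N <- s) _ in h1 h2 *.
have q1 : `|smears b s f 0 - smears b s fc 0| <= M * (1 - smears b s chi 0).
  rewrite -smearsB -(smears_cst b 1 0 Ds) -smearsB -smearsZ.
  apply: smears_norm_le => // x; rewrite /fc -{1}[f x]mulr1 -mulrBr normrM.
  rewrite ler_pM// ger0_norm// subr_ge0; exact: cutoff_le1.
have q2 : `|smooth 1 fc 0 - smooth 1 f 0| <= 8 * M / k ^+ 2.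
  rewrite (smoothB 0 mfc mf ltr01 fcM fM).
  apply: smooth_tail => //; first exact: measurable_funB.
    move=> y; rewrite /fc -{2}[f y]mulr1 -mulrBr normrM -[leRHS]mulr1 ler_pM//.
    by rewrite ler_norml; have := cutoff_ge0 k y; have := cutoff_le1 k y; rewrite /chi; lra.
  by move=> y yk; rewrite /fc /chi cutoff_in// mulr1 subrr.
have q3 : `|smooth 1 chi 0 - 1| <= 8 * 1 / k ^+ 2.
  rewrite -[X in _ - X](smooth_cst 1 0 (ltr01 : 0 < 1 :> R)).
  rewrite (smoothB 0 mc (measurable_cst _) ltr01 chi1 (M := 1)) ?normr1//.
    apply: smooth_tail => //; first exact: measurable_funB.
      move=> y; rewrite ler_norml /cst /chi.
      by have := cutoff_ge0 k y; have := cutoff_le1 k y; lra.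
    by move=> y yk; rewrite /chi cutoff_in// subrr.
  by move=> y; rewrite /cst normr1.
have q4 : M * (1 - smears b s chi 0) <= eta / 4 + M * C2 * S + 8 * M / k ^+ 2.
  have : 1 - smears b s chi 0 <= eta / (4 * (M + 1)) + C2 * S + 8 * 1 / k ^+ 2.
    by move: h2 q3; rewrite !ler_norml => /andP[? ?] /andP[? ?]; lra.
  have h4 : M * (eta / (4 * (M + 1))) <= eta / 4.
    have -> : M * (eta / (4 * (M + 1))) = eta / 4 * (M / (M + 1)) by field; lra.
    by rewrite ler_piMr ?(ltW eta8)// ler_pdivrMr; lra.
  have -> : 8 * M / k ^+ 2 = M * (8 * 1 / k ^+ 2) by rewrite mulr1 mulrCA mulrA.
  move=> /(ler_wpM2l M0) h3; apply: (le_trans h3).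
  by rewrite 2!mulrDr (mulrA M C2) !lerD2r.
apply: le_trans (ler_distD (smears b s fc 0) _ _) _.
apply: le_trans (lerD (le_trans q1 q4) (le_trans (ler_distD (smooth 1 fc 0) _ _) (lerD h1 q2))) _.
have -> : 8 * M / k ^+ 2 = 16 * M / k ^+ 2 / 2 by field; rewrite gt_eqF.
by move: tail; rewrite (mulrDl C1 _ S); lra.
Qed.

End lindeberg_limit.


(** * Integrals against the normal law and against finite partitions *)

Section normal_integral.
Variable R : realType.
Notation mu := (@lebesgue_measure R).

Lemma bounded_integrable d (T : measurableType d) (P : probability T R)
    (A : set T) (F : T -> R) M : measurable A -> measurable_fun [set: T] F ->
  (forall x, `|F x| <= M) -> P.-integrable A (EFin \o F).
Proof.
move=> mA mF FM; apply: (@le_integrable _ _ _ P _ mA _ (EFin \o cst M)).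
- by apply/measurable_EFinP; exact: measurable_funTS.
- by move=> x _ /=; rewrite lee_fin (le_trans (FM x))// ler_norm.
- exact: finite_measure_integrable_cst.
Qed.

(** [smooth 1 f 0] is the integral of f against the standard normal density,
    and that density is a Radon-Nikodym derivative of [normal_prob 0 1]. *)
Lemma integral_normal_prob (f : R -> R) M : measurable_fun [set: R] f ->
  (forall x, `|f x| <= M) ->
  (\int[normal_prob 0 1]_x (f x)%:E = (smooth 1 f 0)%:E)%E.
Proof.
move=> mf fM.
have mfE : measurable_fun [set: R] (EFin \o f) by exact/measurable_EFinP.
have dom : @normal_prob R 0 1 `<< mu by exact: normal_prob_dominates.
rewrite -(Radon_Nikodym_change_of_variables dom)//=; last first.
  apply: (@bounded_integrable _ (measurableTypeR R) (normal_prob 0 1) setT f M) => //.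
transitivity (\int[mu]_x ((f x)%:E * (normal_pdf 0 1 x)%:E))%E.
  apply: ae_eq_integral => //.
  - apply: emeasurable_funM; first exact: mfE.
    by apply: (measurable_int mu); apply: Radon_Nikodym_integrable; exact: dom.
  - apply: emeasurable_funM; first exact: mfE.
    by apply/measurable_EFinP; exact: measurable_normal_pdf.
  - apply: ae_eqe_mul2l => /=.
    rewrite Radon_NikodymE//=.
    case: cid => /= k [k1 k2 k3].
    apply: integral_ae_eq => //=.
    + by apply/measurable_EFinP; exact: measurable_normal_pdf.
    + by move=> A _ mA; rewrite -k3.
have E y : f y * normal_pdf 0 1 y = normalizer R * (f y * kernel 1 (y - 0)).
  by rewrite -[X in normal_pdf _ X](sqrtr1 R) normal_pdf_kernel// mulrCA.
rewrite /smooth -RintegralZl//; last exact: (bounded_kernel_itg _ _ _ fM).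
rewrite /Rintegral fineK.
  by apply: eq_integral => y _; rewrite -EFinM E.
apply: integrable_fin_num => //.
exact/itgZ/(bounded_kernel_itg _ _ _ fM).
Qed.

End normal_integral.

Section partition.
Variables (R : realType) (d : measure_display) (T : measurableType d).
Variables (P : probability T R) (n : nat) (E : 'I_n -> set T).
Hypothesis mE : forall i, measurable (E i).
Hypothesis tE : trivIset setT E.
Hypothesis sumE : (\sum_i P (E i) = 1)%E.

Lemma Rintegral_partition (A : set T) (F : T -> R) M : measurable A ->
  measurable_fun [set: T] F -> (forall x, `|F x| <= M) ->
  \int[P]_(x in A) F x = \sum_i \int[P]_(x in A `&` E i) F x.
Proof.
move=> mA mF FM; pose U := \big[setU/set0]_i E i.
have mU : measurable U by exact: bigsetU_measurable.
have U1 : P U = 1%E by rewrite /U measure_bigsetU_ord.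
have U0 : P (~` U) = 0%E by rewrite probability_setC// U1 subee.
have AU : A `\` ~` U = \big[setU/set0]_(i < n) (A `&` E i).
  by rewrite setDE setCK /U big_distrr.
have iF i : P.-integrable (A `&` E i) (EFin \o F).
  by apply: (bounded_integrable _ _ _ FM) => //; exact: measurableI.
rewrite /Rintegral (@negligible_integral _ _ _ P A (~` U))//; last 2 first.
- exact: measurableC.
- exact: (bounded_integrable _ _ _ FM).
rewrite AU integral_bigsetU_EFin//.
- by rewrite -sum_fine// => i _; apply: integrable_fin_num; [exact: measurableI|exact: iF].
- by move=> i; exact: measurableI.
- exact: index_enum_uniq.
- apply: sub_trivIset (@subsetT _ _) _ => i j _ _ [x [[_ xi] [_ xj]]].
  by apply: (tE I I); exists x.
- by apply/measurable_EFinP; exact: measurable_funTS.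
Qed.

End partition.


(** * Positions on the circle and the law of large numbers *)

Section circle_lemmas.
Variable R : realType.

Lemma to_circleK (c : circle R) : to_circle (circle_val c) = c.
Proof.
rewrite -[RHS]reprK; apply/eqmodP; rewrite /= /eq_mod1 /circle_val.
by rewrite addrAC subrr sub0r rpredN intr_int.
Qed.

Lemma circle_val_label N n : (n < N)%N ->
  circle_val (to_circle (n%:R / N%:R : R)) = n%:R / N%:R.
Proof.
move=> nN; have N0 : (0 : R) < N%:R by rewrite ltr0n; apply: leq_ltn_trans nN.
rewrite circle_val_to_circle (@floor_def _ _ 0) ?subr0//.
by rewrite divr_ge0//= ltr_pdivrMr// mul1r ltr_nat.
Qed.

(** [circle_val] is injective and measurable. *)
Lemma measurable_circle1 (c : circle R) : measurable [set c].
Proof.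
have -> : [set c] = @circle_val R @^-1` [set circle_val c].
  apply/seteqP; split => [x ->//|x /= xc].
  by rewrite -(to_circleK x) xc to_circleK.
by rewrite -[_ @^-1` _]setTI; apply: measurable_circle_val.
Qed.

Lemma measurable_circle_continuous (f : circle R -> R) :
  continuous f -> measurable_fun [set: circle R] f.
Proof.
move=> /continuousP cf _; apply: (measurability _ (RGenOInfty.measurableE R)) => //.
move=> /= _ [_ [a ->] <-]; rewrite setTI.
by apply: sub_sigma_algebra; apply: cf; exact: rray_open.
Qed.

Lemma continuous_to_circle : continuous (@to_circle R).
Proof. exact: pi_continuous. Qed.

End circle_lemmas.

Section survivor_law.
Variables (R : realType) (p : R) (N : nat).
Variables (d : measure_display) (Omega : measurableType d).
Variables (P : probability Omega R) (X : {RV P >-> circle R}).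
Hypothesis N_gt0 : (0 < N)%N.
Hypothesis X_law : is_survivor_position p N X.

Definition survivor_event (n : 'I_N) : set Omega :=
  X @^-1` [set to_circle (n%:R / N%:R)].

Lemma measurable_survivor_event n : measurable (survivor_event n).
Proof.
by rewrite /survivor_event -[_ @^-1` _]setTI; apply: measurable_funPT => //; exact: measurable_circle1.
Qed.

Lemma trivIset_survivor_event : trivIset setT survivor_event.
Proof.
move=> i j _ _ [x [xi xj]].
have := congr1 (@circle_val R) (etrans (esym xi) xj).
rewrite !circle_val_label// => /mulIf ij; apply: ord_inj; apply/eqP.
by rewrite -(eqr_nat R) ij// invr_neq0// pnatr_eq0 -lt0n.
Qed.

Lemma survivor_event_sum1 : (\sum_n P (survivor_event n) = 1)%E.
Proof.
have e := @mean_cst R p N.-1 1; rewrite prednK// in e.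
rewrite -[in RHS]e /mean -sumEFin; apply: eq_bigr => i _.
by rewrite X_law// mulr1.
Qed.

Lemma Rintegral_survivor_event (A : set Omega) (F : Omega -> R) M : measurable A ->
  measurable_fun setT F -> (forall x, `|F x| <= M) ->
  \int[P]_(x in A) F x = \sum_(n < N) \int[P]_(x in A `&` survivor_event n) F x.
Proof.
exact: Rintegral_partition measurable_survivor_event trivIset_survivor_event
  survivor_event_sum1 _ _ _.
Qed.

Lemma survivor_mean (F : circle R -> R) M : measurable_fun [set: circle R] F ->
  (forall x, `|F x| <= M) ->
  \int[P]_x F (X x) = mean p N (fun n => F (to_circle (n%:R / N%:R))).
Proof.
move=> mF FM; rewrite (Rintegral_survivor_event (F := F \o X) (M := M))//; last 2 first.
- exact: measurableT_comp.
- by move=> x; exact: FM.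
apply: eq_bigr => n _; rewrite setTI.
transitivity (\int[P]_(x in survivor_event n) (F (to_circle (n%:R / N%:R)))).
  by apply: eq_Rintegral => x; rewrite inE /survivor_event /= => ->.
rewrite Rintegral_cst; last exact: measurable_survivor_event.
rewrite [fine _](_ : _ = survival_prob p N n); first by rewrite mulrC.
exact: (congr1 fine (X_law (ltn_ord n))).
Qed.

Lemma integral_distribution_survivor (F : circle R -> R) M :
  measurable_fun [set: circle R] F -> (forall x, `|F x| <= M) ->
  (\int[distribution P X]_x (F x)%:E =
   (mean p N (fun n => F (to_circle (n%:R / N%:R))))%:E)%E.
Proof.
move=> mF FM.
have iF : P.-integrable setT (EFin \o (F \o X)).
  apply: (@bounded_integrable _ _ _ P setT (F \o X) M) => //; first exact: measurableT_comp.
  by move=> x; exact: FM.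
rewrite integral_distribution//; last exact/measurable_EFinP.
by rewrite -(survivor_mean mF FM) /Rintegral fineK// integrable_fin_num.
Qed.

Lemma probability_survivor (A : set (circle R)) : measurable A ->
  P (X @^-1` A) = (mean p N (fun n => \1_A (to_circle (n%:R / N%:R))))%:E.
Proof.
move=> mA; rewrite -(@integral_distribution_survivor (\1_A) 1)//.
- by rewrite integral_indic// setIT.
- by move=> x; rewrite indicE ger0_norm ?lern1 ?leq_b1// ler_nat leq_b1.
Qed.

End survivor_law.

Section law_of_large_numbers.
Variables (R : realType) (p : R).
Hypothesis p01 : 0 < p < 1.

Lemma survivor_chebyshev : exists2 K : R, 0 <= K & forall (N : nat) (delta : R), (0 < N)%N ->
  0 < delta ->
  mean p N (fun n => (delta <= `|n%:R / N%:R - 1 / 2|)%R%:R) <= K / (delta ^+ 2 * N%:R).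
Proof.
have [K K0 hK] := mean_sqr_offset_le p01.
exists K => // -[//|N] delta _ delta0.
have N0 : (0 : R) < N.+1%:R by rewrite ltr0n.
have dN : 0 < (delta * N.+1%:R) ^+ 2 by rewrite exprn_gt0// mulr_gt0.
apply: (@le_trans _ _ ((delta * N.+1%:R) ^- 2 * mean p N.+1 (fun n => offset R N.+1 n ^+ 2))).
  rewrite -meanZ; apply: le_mean => // n nN.
  case: (leP delta _) => [h|_] /=; last by rewrite mulr_ge0 ?sqr_ge0 ?invr_ge0 ?(ltW dN).
  rewrite ler_pdivlMl// mulr1.
  have -> : offset R N.+1 n = (n%:R / N.+1%:R - 1 / 2) * N.+1%:R.
    by rewrite /offset; field; rewrite gt_eqF.
  rewrite -[leRHS]real_normK ?num_real// normrM (ger0_norm (ltW N0)).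
  by rewrite lerXn2r ?nnegrE ?mulr_ge0 ?(ltW delta0)// ler_wpM2r// ltW.
apply: le_trans (ler_wpM2l _ (hK N)) _; first by rewrite invr_ge0 ltW.
by rewrite le_eqVlt; apply/orP; left; apply/eqP; field; rewrite !gt_eqF.
Qed.

(** f is close to its value at 1 / 2 near 1 / 2 by continuity; the probability
    of being away from 1 / 2 tends to 0 by Chebyshev's inequality. *)
Lemma mean_cvg_half (f : circle R -> R) M : continuous f -> (forall x, `|f x| <= M) ->
  mean p N (fun n => f (to_circle (n%:R / N%:R))) @[N --> \oo] -->
    f (to_circle (1 / 2)).
Proof.
move=> cf fM; have M0 : 0 <= M by apply: le_trans (fM point).
have [K K0 hK] := survivor_chebyshev.
apply/cvgrPdist_le => eta eta0.
have eta2 : 0 < eta / 2 by rewrite divr_gt0.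
have /cvgrPdist_lt /(_ _ eta2) : {for (1 / 2 : R), continuous (f \o @to_circle R)}.
  by apply: continuous_comp; [exact: continuous_to_circle|exact: cf].
move=> [delta /= delta0 hd].
pose c := 2 * M * (K / delta ^+ 2).
have c0 : 0 <= c by rewrite !mulr_ge0 ?invr_ge0 ?exprn_ge0 ?(ltW delta0).
suff main N : (0 < N)%N -> c / N%:R <= eta / 2 ->
    `|f (to_circle (1 / 2)) - mean p N (fun n => f (to_circle (n%:R / N%:R)))| <= eta.
  near=> N; have N0 : (0 < N)%N by near: N; exact: nbhs_infty_gt.
  apply: main => //; rewrite ler_pdivrMr ?ltr0n// mulrC -ler_pdivrMr//.
  by near: N; exact: nbhs_infty_ger.
case: N => // N _ cN.
rewrite distrC; set v := f _.
rewrite -[v](mean_cst p N) -mulN1r -meanZ -meanD.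
have h n : (n < N.+1)%N -> `|f (to_circle (n%:R / N.+1%:R)) + -1 * v| <=
    eta / 2 + 2 * M * (delta <= `|n%:R / N.+1%:R - 1 / 2|)%R%:R.
  move=> nN; rewrite mulN1r; case: (leP delta _) => /= [_|h].
    rewrite mulr1; apply: le_trans (ler_normB _ _) _.
    have := fM (to_circle (1 / 2)); have := fM (to_circle (n%:R / N.+1%:R)).
    by rewrite /v; lra.
  rewrite mulr0 addr0 distrC ltW//; apply: hd; by rewrite /ball_/= distrC.
have hc := hK N.+1 delta isT delta0.
have hs : 2 * M * (K / (delta ^+ 2 * N.+1%:R)) = c / N.+1%:R.
  by rewrite /c; field; rewrite !gt_eqF.
have M2 : 0 <= 2 * M by rewrite mulr_ge0.
have bound (phi : nat -> R) : (forall n, (n < N.+1)%N -> phi n <=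
    eta / 2 + 2 * M * (delta <= `|n%:R / N.+1%:R - 1 / 2|)%R%:R) ->
    mean p N.+1 phi <= eta.
  move=> /(le_mean p01) hphi; apply: le_trans hphi _.
  rewrite meanD mean_cst meanZ.
  have := ler_wpM2l M2 hc; rewrite hs => h3.
  by apply: le_trans (lerD (lexx _) (le_trans h3 cN)) _; lra.
rewrite ler_norml; apply/andP; split.
  rewrite lerNl -[leLHS]mulN1r -meanZ; apply: bound => n nN.
  by apply: le_trans (h n nN); rewrite !mulN1r -normrN ler_norm.
by apply: bound => n nN; apply: le_trans (h n nN); rewrite ler_norm.
Unshelve. all: by end_near. Qed.

End law_of_large_numbers.


(** * Sums of independent survivor positions *)

Section independence.
Variables (R : realType) (p : R).
Variables (d : measure_display) (Omega : measurableType d).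
Variables (P : probability Omega R) (X : nat -> {RV P >-> circle R}).
Hypothesis X_law : forall N, (3 <= N)%N -> is_survivor_position p N (X N).
Hypothesis X_indep :
  mutually_independent [set N | (3 <= N)%N] (fun N => real_position (X N)).

Local Notation Y N := (real_position (X N)).

Definition deviation (N n : nat) : R := n%:R / N%:R - 1 / 2.

Local Notation smears := (smears id (survival_prob p) deviation).

Lemma survivor_eventE N (n : 'I_N) :
  survivor_event (X N) n = Y N @^-1` [set n%:R / N%:R].
Proof.
rewrite /survivor_event /real_position; apply/seteqP; split => x /=.
  by move=> ->; rewrite circle_val_label.
by rewrite -(circle_val_label R (ltn_ord n)) => /(congr1 (@to_circle R)); rewrite !to_circleK.
Qed.

Lemma measurable_joint_event (J : {fset nat}) (A : nat -> set R) :
  (forall j, measurable (A j)) ->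
  measurable (\bigcap_(j in [set` J]) (Y j @^-1` A j)).
Proof.
move=> mA; apply: fin_bigcap_measurable => // j _.
by rewrite -[_ @^-1` _]setTI; exact: measurable_funPT.
Qed.

Lemma measurable_deviation_sum (s : seq nat) (b c : R) :
  measurable_fun [set: Omega] (fun x => c + b * \sum_(N <- s) (Y N x - 1 / 2)).
Proof.
apply: measurable_funD => //; apply: measurable_funM => //.
apply: measurable_sum => N; exact: measurable_funB.
Qed.

(** The event is a parameter of the induction: summing over the values of the
    first remaining variable fixes that variable, which joins the event, and
    independence of the enlarged family of events produces its weight. *)
Lemma independent_smears (f : R -> R) (M b : R) (s : seq nat) :
  measurable_fun [set: R] f -> (forall y, `|f y| <= M) ->
  uniq s -> all (leq 3) s ->
  forall (J : {fset nat}) (A : nat -> set R) (c : R),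
  [set` J] `<=` [set N | (3 <= N)%N] -> (forall j, measurable (A j)) ->
  (forall j, j \in s -> j \notin J) ->
  \int[P]_(x in \bigcap_(j in [set` J]) (Y j @^-1` A j))
    f (c + b * \sum_(N <- s) (Y N x - 1 / 2)) =
  fine (P (\bigcap_(j in [set` J]) (Y j @^-1` A j))) * smears b s f c.
Proof.
move=> mf fM; elim: s => [_ _|N s IH /andP[Ns us] /andP[N3 s3]] J A c J3 mA sJ.
  under eq_Rintegral do rewrite big_nil mulr0 addr0.
  rewrite Rintegral_cst; last exact: measurable_joint_event.
  exact: mulrC.
have N0 : (0 < N)%N by exact: leq_trans N3.
have mE := measurable_joint_event J mA.
rewrite (Rintegral_survivor_event N0 (X_law N3) mE (M := M)); last 2 first.
- by apply: measurableT_comp => //; exact: measurable_deviation_sum.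
- by move=> x; exact: fM.
rewrite smears_cons big_distrr; apply: eq_bigr => n _ /=.
(* The event that the variable N takes its n-th value, joined to the others. *)
pose A' j := if j == N then [set n%:R / N%:R] else A j.
pose J' := (N |` J)%fset.
have mA' j : measurable (A' j) by rewrite /A'; case: ifP.
have J'3 : [set` J'] `<=` [set N | (3 <= N)%N].
  by move=> j /=; rewrite in_fset1U => /orP[/eqP ->//|jJ]; exact: J3.
have NJ : N \notin J by apply: sJ; rewrite mem_head.
have A'J j : j \in J -> A' j = A j.
  by rewrite /A'; case: eqP => // -> NJ'; rewrite NJ' in NJ.
have E : \bigcap_(j in [set` J]) (Y j @^-1` A j) `&` survivor_event (X N) n =
    \bigcap_(j in [set` J']) (Y j @^-1` A' j).
  rewrite survivor_eventE; apply/seteqP; split => x.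
    move=> [xJ xN] j /=; rewrite in_fset1U => /orP[/eqP ->|jJ].
      by rewrite /A' eqxx.
    by rewrite A'J//; exact: xJ.
  move=> xJ'; split.
    move=> j /= jJ; rewrite -A'J//; apply: xJ'.
    by rewrite /= in_fset1U jJ orbT.
  have := xJ' N; rewrite /A' eqxx; apply.
  by rewrite /= in_fset1U eqxx.
have PE : fine (P (\bigcap_(j in [set` J']) (Y j @^-1` A' j))) =
    survival_prob p N n * fine (P (\bigcap_(j in [set` J]) (Y j @^-1` A j))).
  rewrite (X_indep J'3 mA') (X_indep J3 mA) /J' big_fsetU1//=.
  rewrite /A' eqxx -survivor_eventE X_law//.
  rewrite (eq_big_seq (fun j => P (Y j @^-1` A j))) => [|j jJ]; last by rewrite -/(A' j) A'J.
  rewrite fineM//; rewrite -(X_indep J3 mA).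
  exact: fin_num_measure.
have sJ' j : j \in s -> j \notin J'.
  move=> js; rewrite in_fset1U negb_or sJ ?in_cons ?js ?orbT// andbT.
  by apply: contraNneq Ns => <-.
transitivity (\int[P]_(x in \bigcap_(j in [set` J']) (Y j @^-1` A' j))
    f (c + b * deviation N n + b * \sum_(k <- s) (Y k x - 1 / 2))).
  rewrite -E; apply: eq_Rintegral => x; rewrite inE => -[_].
  rewrite survivor_eventE /= => xN.
  by rewrite big_cons xN mulrDr addrA.
rewrite IH// PE; ring.
Qed.

Lemma normalized_sumE L x : normalized_sum (fun N => Y N) L x =
  (total_deviation (fun N => Y N) L)^-1 * \sum_(3 <= N < L.+1) (Y N x - 1 / 2).
Proof.
rewrite /normalized_sum /=; congr (_ * _).
elim/big_ind2 : _ => // [u1 v1 u2 v2 <- <-] //.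
Qed.

Lemma integral_normalized_sum (f : R -> R) M L : measurable_fun [set: R] f -> (forall y, `|f y| <= M) ->
  (\int[distribution P (normalized_sum (fun N => Y N) L)]_x (f x)%:E =
   (smears (total_deviation (fun N => Y N) L)^-1 (index_iota 3 L.+1) f 0)%:E)%E.
Proof.
move=> mf fM; set W := normalized_sum _ L.
have mfW : measurable_fun [set: Omega] (f \o W) by apply: measurableT_comp.
have iF : P.-integrable setT (EFin \o (f \o W)).
  by apply: (@bounded_integrable _ _ _ P setT (f \o W) M) => // x; exact: fM.
rewrite integral_distribution//; last exact/measurable_EFinP.
pose b := (total_deviation (fun N => Y N) L)^-1.
have h : \int[P]_x f (0 + b * \sum_(N <- index_iota 3 L.+1) (Y N x - 1 / 2)) =
    smears b (index_iota 3 L.+1) f 0.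
  have s3 : all (leq 3) (index_iota 3 L.+1).
    by apply/allP => j; rewrite mem_index_iota => /andP[].
  have := @independent_smears f M b _ mf fM (iota_uniq _ _) s3 fset0 (fun=> setT) 0.
  rewrite (_ : \bigcap_(j in _) _ = setT); last by apply/seteqP; split => // x _ j.
  by rewrite probability_setT => ->//=; rewrite ?mul1r.
rewrite -/b -h -[LHS]fineK ?integrable_fin_num//; congr (fine _)%:E.
by apply: eq_integral => x _; rewrite add0r -normalized_sumE.
Qed.

Lemma expectation_position N (phi : R -> R) M : (3 <= N)%N -> measurable_fun [set: R] phi ->
  (forall y, `|phi (circle_val y)| <= M) ->
  ('E_P[phi \o Y N] = (mean p N (fun n => phi (n%:R / N%:R)))%:E)%E.
Proof.
move=> N3 mphi phiM.
have N0 : (0 < N)%N by exact: leq_trans N3.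
have mF : measurable_fun [set: circle R] (phi \o @circle_val R).
  by apply: measurableT_comp => //; exact: measurable_circle_val.
have e := survivor_mean N0 (X_law N3) mF phiM.
have iF : P.-integrable setT (EFin \o ((phi \o @circle_val R) \o X N)).
  apply: (@bounded_integrable _ _ _ P setT _ M) => //; first exact: measurableT_comp.
  by move=> x; exact: phiM.
rewrite unlock -[LHS]fineK ?integrable_fin_num//; congr EFin.
transitivity (\int[P]_x (phi \o @circle_val R) (X N x)) => //.
by rewrite e; apply: eq_mean => n nN /=; rewrite circle_val_label.
Qed.

Lemma circle_val_norm_le (y : circle R) : `|circle_val y| <= 1.
Proof.
rewrite /circle_val ger0_norm ?subr_ge0 ?floor_le// lerBlDl.
by have := floorD1_gt (repr y); rewrite intrD => /ltW; rewrite addrC.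
Qed.

Lemma variance_position N : (3 <= N)%N ->
  fine 'V_P[Y N]%E = spread id (survival_prob p) deviation N.
Proof.
move=> N3.
have E1 : ('E_P[Y N] = (mean p N (fun n => n%:R / N%:R))%:E)%E.
  by apply: (@expectation_position N id 1) => // y; exact: circle_val_norm_le.
set mu := mean _ _ _ in E1.
rewrite /variance unlock E1 /=.
have -> : ((Y N \- cst mu) * (Y N \- cst mu))%R = (fun y => (y - mu) ^+ 2) \o Y N :> (Omega -> R).
  by apply/funext => x.
rewrite (@expectation_position N (fun y => (y - mu) ^+ 2) ((1 + `|mu|) ^+ 2))//=; last 2 first.
- by apply: measurable_funX; exact: measurable_funB.
- move=> y; rewrite normrX lerXn2r ?nnegrE ?addr_ge0//.
  by apply: le_trans (ler_normB _ _) _; rewrite lerD2r circle_val_norm_le.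
have N0 : (0 < N)%N by exact: leq_trans N3.
rewrite /spread /moment2 /moment1.
have m1 : avg id (survival_prob p) N (deviation N) = mu - 1 / 2.
  by rewrite /mu -(prednK N0) -[X in _ - X](mean_cst p N.-1) -mulN1r -meanZ -meanD;
    apply: eq_mean => n _; rewrite mulN1r.
rewrite m1.
have -> : avg id (survival_prob p) N (fun i => deviation N i ^+ 2) =
    mean p N (fun n => (n%:R / N%:R - mu) ^+ 2 +
      (2 * (mu - 1 / 2) * (n%:R / N%:R) + (1 / 4 - mu ^+ 2))).
  by apply: eq_mean => n _; rewrite /deviation; field; rewrite pnatr_eq0 -lt0n.
by rewrite 2!meanD meanZ -/mu -(prednK N0) mean_cst prednK//; field.
Qed.

End independence.


(** * Growth of the total variance for p = 1/2 *)

Section logarithmic_growth.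
Variable R : realType.

(** Both bounds telescope from 1/(N+1) <= ln (N+1) - ln N <= 1/N. *)
Lemma harmonic_ln_near (L : nat) : (2 <= L)%N ->
  ln (L.+1%:R : R) - ln 3 <= \sum_(3 <= N < L.+1) N%:R^-1 <= ln (L%:R : R).
Proof.
have ratio_ge (N : nat) : (0 < N)%N -> ln (N.+1%:R : R) - ln N%:R <= N%:R^-1.
  move=> N0; have N0' : (0 : R) < N%:R by rewrite ltr0n.
  rewrite -ln_div ?posrE ?ltr0n//.
  have -> : N.+1%:R / N%:R = 1 + N%:R^-1 :> R.
    by rewrite -addn1 natrD mulrDl divff ?mul1r// gt_eqF.
  have i0 : 0 < N%:R^-1 :> R by rewrite invr_gt0.
  by apply: le_ln1Dx; lra.
have ratio_le (N : nat) : (0 < N)%N -> N.+1%:R^-1 <= ln (N.+1%:R : R) - ln N%:R.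
  move=> N0; have N0' : (0 : R) < N%:R by rewrite ltr0n.
  rewrite -[leRHS]opprB -ln_div ?posrE ?ltr0n// lerNr.
  have -> : N%:R / N.+1%:R = 1 + (- N.+1%:R^-1) :> R.
    by rewrite -(addn1 N) natrD; field; have := ler0n R N; lra.
  by apply: le_ln1Dx; rewrite ltrN2 invf_lt1 ?ltr0n// ltr1n ltnS.
elim: L => // L IH; rewrite leq_eqVlt => /orP[/eqP <-|L2].
  by rewrite big_geq// subrr lexx ln_ge0// ler1n.
have {IH} /andP[h1 h2] := IH L2.
rewrite big_nat_recr/=; last by rewrite ltnS.
have L0 : (0 < L)%N by apply: leq_trans (L2 : (2 <= L)%N).
have a := ratio_ge L.+1 isT; have b := ratio_le L L0; apply/andP; split.
  by apply: le_trans (lerD h1 a); rewrite [leRHS]addrC addrA subrK.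
by apply: le_trans (lerD h2 b) _; rewrite addrC subrK.
Qed.

Lemma inverse_squares_le (L : nat) : (2 <= L)%N ->
  \sum_(3 <= N < L.+1) (N%:R : R) ^- 2 <= 2^-1 - L%:R^-1.
Proof.
elim: L => // L IH; rewrite leq_eqVlt => /orP[/eqP <-|L2].
  by rewrite big_geq// subrr.
rewrite big_nat_recr/=; last by rewrite ltnS.
apply: le_trans (lerD (IH L2) (lexx _)) _.
have L0 : (0 : R) < L%:R by rewrite ltr0n; apply: leq_trans (L2 : (2 <= L)%N).
have -> : 2^-1 - L.+1%:R^-1 = 2^-1 - L%:R^-1 + (L%:R * L.+1%:R)^-1 :> R.
  by rewrite -(addn1 L) natrD; field; have := ler0n R L; rewrite gt_eqF//; lra.
rewrite lerD2l lef_pV2 ?posrE ?exprn_gt0 ?mulr_gt0 ?ltr0n//.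
  by rewrite expr2 ler_wpM2r// ler_nat.
by rewrite -(ltr0n R).
Qed.

Local Notation p := (1 / 2 : R).

Lemma half01 : 0 < p < 1.
Proof. lra. Qed.

Local Notation avgs := (survival_prob p).
Local Notation m1 N := (moment1 id avgs (@deviation R) N).
Local Notation sp N := (spread id avgs (@deviation R) N).

Lemma deviation_offset N n : (0 < N)%N ->
  deviation R N n = N%:R^-1 * offset R N n.
Proof.
by move=> N0; rewrite /deviation /offset; field; rewrite pnatr_eq0 -lt0n.
Qed.

Lemma moment1_offset N : (0 < N)%N -> m1 N = N%:R^-1 * mean p N (offset R N).
Proof.
by move=> N0; rewrite -meanZ; apply: eq_mean => n _; rewrite deviation_offset.
Qed.

Lemma moment2_offset N : (0 < N)%N ->
  moment2 id avgs (@deviation R) N = N%:R ^- 2 * mean p N (fun n => offset R N n ^+ 2).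
Proof.
move=> N0; rewrite -meanZ; apply: eq_mean => n _.
by rewrite deviation_offset// exprMn exprVn.
Qed.

Lemma spread_near : exists2 K : R, 0 <= K &
  forall N, (0 < N)%N -> `|sp N - 9 / 4 * N%:R^-1| <= K * N%:R ^- 2.
Proof.
have [K K0 hK] := mean_sqr_offset_near half01 erefl.
have [K' K'0 hK'] := mean_offset_bounded half01.
exists (K + K' ^+ 2) => [|[//|N] _]; first by rewrite addr_ge0// sqr_ge0.
have N0 : (0 : R) < N.+1%:R by rewrite ltr0n.
rewrite /spread moment1_offset// moment2_offset//.
set z2 := mean _ _ _; set z1 := mean _ _ _.
have -> : N.+1%:R ^- 2 * z2 - (N.+1%:R^-1 * z1) ^+ 2 - 9 / 4 * N.+1%:R^-1 =
    ((z2 - 9 / 4 * N.+1%:R) - z1 ^+ 2) * N.+1%:R ^- 2.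
  by field; rewrite gt_eqF.
have N2 : 0 <= N.+1%:R ^- 2 :> R by rewrite invr_ge0 exprn_ge0 ?(ltW N0).
rewrite normrM (ger0_norm N2) ler_wpM2r//.
apply: le_trans (ler_normB _ _) _; apply: lerD; first exact: hK.
rewrite normrX lerXn2r ?nnegrE//; exact: hK'.
Qed.

Lemma sum_spread_near : exists2 K : R, 0 <= K &
  forall L, (3 <= L)%N -> `|\sum_(3 <= N < L.+1) sp N - 9 / 4 * ln L%:R| <= K.
Proof.
have [K K0 hK] := spread_near.
exists (K + 9 / 4 * ln 3) => [|L L3].
  by rewrite addr_ge0// mulr_ge0// ln_ge0// ler1n.
have /andP[h1 h2] := harmonic_ln_near (ltnW L3).
have lnS : ln (L%:R : R) <= ln L.+1%:R.
  by rewrite ler_ln ?posrE ?ltr0n ?ler_nat//; apply: leq_trans L3.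
have sq := inverse_squares_le (ltnW L3).
have L0 : 0 < L%:R^-1 :> R by rewrite invr_gt0 ltr0n; apply: leq_trans L3.
have : `|\sum_(3 <= N < L.+1) sp N - 9 / 4 * \sum_(3 <= N < L.+1) N%:R^-1| <= K.
  rewrite big_distrr/= -sumrB; apply: le_trans (ler_norm_sum _ _ _) _.
  apply: (@le_trans _ _ (\sum_(3 <= N < L.+1) K * N%:R ^- 2)).
    rewrite !big_nat; apply: ler_sum => N /andP[N3 _].
    by apply: hK; exact: leq_trans N3.
  by rewrite -big_distrr/= ler_piMr//; lra.
rewrite !ler_norml => /andP[h3 h4]; apply/andP; split; lra.
Qed.

Lemma sum_moment1_bounded : exists2 K : R, 0 <= K &
  forall L, \sum_(3 <= N < L.+1) `|m1 N| <= K.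
Proof.
have [K K0 hK] := sum_mean_offset_bounded half01 erefl.
exists K => // L; apply: le_trans (hK L).
pose F N := `|mean p N (offset R N)|.
apply: (@le_trans _ _ (\sum_(3 <= N < L.+1) F N)).
  rewrite !big_nat; apply: ler_sum => N /andP[N3 _].
  have N0 : (0 < N)%N by exact: leq_trans N3.
  rewrite moment1_offset// normrM ger0_norm ?invr_ge0// ler_piMl//.
  by rewrite invf_le1 ?ltr0n// ler1n.
have -> : \sum_(N < L) `|mean p N.+1 (offset R N.+1)| = \sum_(1 <= N < L.+1) F N.
  by rewrite big_add1/= big_mkord.
have [L2|L2] := leqP 2 L.
  by rewrite [leRHS](@big_cat_nat _ _ _ 3)// lerDr; apply: sumr_ge0 => N _; exact: normr_ge0.
by rewrite big_geq ?(leq_trans L2)//; apply: sumr_ge0 => N _; exact: normr_ge0.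
Qed.

End logarithmic_growth.


(** * Limit theorems *)

Section weak_limit.
Variables (R : realType) (p : R).
Hypothesis p01 : 0 < p < 1.
Variables (d : nat -> measure_display) (Omega : forall N, measurableType (d N)).
Variables (P : forall N, probability (Omega N) R).
Variable X : forall N, {RV (P N) >-> circle R}.
Hypothesis X_law : forall N, (3 <= N)%N -> is_survivor_position p N (X N).

Let half : circle R := to_circle (1 / 2).

(** The limit law is that of the constant 1 / 2, carried by any probability
    space. *)
Lemma cvg_in_law_half (d' : measure_display) (Omega' : measurableType d')
    (Q : probability Omega' R) :
  cvg_in_law_circle (fun N => distribution (P N) (X N))
    (distribution Q (cst half)).
Proof.
move=> f [cf [M fM]].
have mf := measurable_circle_continuous cf.
have -> : (\int[distribution Q (cst half)]_x (f x)%:E = (f half)%:E)%E.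
  rewrite integral_distribution; last 2 first.
  - exact/measurable_EFinP.
  - apply: (@bounded_integrable _ _ _ Q setT (f \o cst half) M) => //.
    exact: measurableT_comp.
    by move=> x; exact: fM.
  transitivity (\int[Q]_x cst (f half)%:E x)%E; first exact: eq_integral.
  rewrite integral_cst// [X in (_ * X)%E](_ : _ = 1%E) ?mule1//.
  exact: (probability_setT Q).
apply: cvg_trans (near_eq_cvg (f := fun N =>
  (mean p N (fun n => f (to_circle (n%:R / N%:R))))%:E) _) _.
  near=> N; have N3 : (3 <= N)%N by near: N; exact: nbhs_infty_ge.
  have N0 : (0 < N)%N by exact: leq_trans N3.
  by rewrite (integral_distribution_survivor N0 (X_law N3) mf fM).
by apply: cvg_EFin; [apply: nearW|exact: (mean_cvg_half p01 cf fM)].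
Unshelve. all: by end_near. Qed.

Lemma measurable_far (e : R) (c : circle R) :
  measurable [set x : circle R | e <= circle_dist x c].
Proof.
have mg : measurable_fun [set: circle R] (fun x => circle_dist x c).
  have mt : measurable_fun [set: circle R] (fun x => `|circle_val x - circle_val c|).
    apply: measurableT_comp => //; apply: measurable_funB => //.
  rewrite (_ : (fun x => circle_dist x c) = (fun x => `|circle_val x - circle_val c|) \min
    (fun x => 1 - `|circle_val x - circle_val c|))//.
  by apply: measurable_minr => //; exact: measurable_funB.
have := mg measurableT `[e, +oo[%classic (measurable_itv _).
rewrite setTI; congr measurable; apply/seteqP.
by split => x /=; rewrite in_itv/= andbT.
Qed.

Lemma cvg_in_probability_half : cvg_in_probability_cst X half.
Proof.
move=> e e0; have [K K0 hK] := survivor_chebyshev p01.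
pose A := [set x : circle R | e <= circle_dist x half].
have mA : measurable A by exact: measurable_far.
apply: cvg_trans (near_eq_cvg (f := fun N =>
  (mean p N (fun n => \1_A (to_circle (n%:R / N%:R))))%:E) _) _.
  near=> N; have N3 : (3 <= N)%N by near: N; exact: nbhs_infty_ge.
  have N0 : (0 < N)%N by exact: leq_trans N3.
  by rewrite -(probability_survivor N0 (X_law N3) mA).
apply: cvg_EFin; first by apply: nearW.
(* 1 / 2 is the position of label 1 among 2 participants. *)
have half_val : circle_val half = 1 / 2 :> R by exact: (@circle_val_label R 2 1).
apply: (@squeeze_cvgr _ _ _ _ (cst 0) (fun N => K / e ^+ 2 * N%:R^-1)).
- near=> N; have N0 : (0 < N)%N by near: N; exact: nbhs_infty_gt.
  apply/andP; split.
    by rewrite sumr_ge0// => n _; rewrite mulr_ge0 ?survival_prob_ge0// indicE.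
  have := hK N e N0 e0; rewrite invfM mulrA; apply: le_trans.
  apply: le_mean => // n nN; rewrite indicE ler_nat.
  case: (boolP (_ \in A)) => //; rewrite inE /A/= /circle_dist half_val circle_val_label//.
  by rewrite le_min => /andP[->].
- exact: cvg_cst.
- rewrite -[X in _ --> X](mulr0 (K / e ^+ 2)); apply: cvgMr.
  apply/gtr0_cvgV0; last exact: cvgr_idn.
  by near=> N; rewrite ltr0n; near: N; exact: nbhs_infty_gt.
Unshelve. all: by end_near. Qed.

End weak_limit.

Section central_limit.
Variable R : realType.
Local Notation p := (1 / 2 : R).
Variables (d : measure_display) (Omega : measurableType d).
Variables (P : probability Omega R) (X : nat -> {RV P >-> circle R}).
Hypothesis X_law : forall N, (3 <= N)%N -> is_survivor_position p N (X N).
Hypothesis X_indep :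
  mutually_independent [set N | (3 <= N)%N] (fun N => real_position (X N)).

Local Notation B L := (total_deviation (fun N => real_position (X N)) L).

Lemma total_deviation_sqrt L :
  B L = Num.sqrt (\sum_(3 <= N < L.+1) spread id (survival_prob p) (@deviation R) N).
Proof.
rewrite /total_deviation; congr Num.sqrt; rewrite !big_nat; apply: eq_bigr => N /andP[N3 _].
exact: (variance_position X_law).
Qed.

Lemma near_ln_ge (a : R) : \forall L \near \oo, a <= ln (L%:R : R).
Proof.
near=> L; rewrite -ler_expR lnK; last first.
  by rewrite posrE ltr0n; near: L; exact: nbhs_infty_gt.
by near: L; exact: nbhs_infty_ger.
Unshelve. all: by end_near. Qed.

(** Since B_L^2 = (9 / 4) ln L + O(1), any constants below and above 9 / 4, here
    1 and 4, bound it eventually. *)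
Lemma total_deviation_log : \forall L \near \oo, 0 < ln (L%:R : R) /\
  Num.sqrt (ln (L%:R : R)) <= B L <= 2 * Num.sqrt (ln (L%:R : R)).
Proof.
have [K K0 hK] := sum_spread_near R.
near=> L.
have L3 : (3 <= L)%N by near: L; exact: nbhs_infty_ge.
have lnK : K + 1 <= ln (L%:R : R) by near: L; exact: near_ln_ge.
have l0 : 0 < ln (L%:R : R) by lra.
split => //.
rewrite total_deviation_sqrt.
have := hK L L3; set S := \sum_(3 <= N < L.+1) _; rewrite ler_norml => /andP[h1 h2].
have -> : 2 * Num.sqrt (ln (L%:R : R)) = Num.sqrt (4 * ln (L%:R : R)).
  have -> : 4 = 2 ^+ 2 :> R by ring.
  by rewrite sqrtrM ?sqr_ge0// sqrtr_sqr ger0_norm.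
by rewrite !ler_sqrt; [apply/andP; split|..]; lra.
Unshelve. all: by end_near. Qed.

Lemma near_total_deviation_ge (a : R) : \forall L \near \oo, a <= B L.
Proof.
near=> L.
have [_ /andP[h _]] : 0 < ln (L%:R : R) /\
    Num.sqrt (ln (L%:R : R)) <= B L <= 2 * Num.sqrt (ln (L%:R : R)).
  by near: L; exact: total_deviation_log.
apply: le_trans h; apply: (le_trans (ler_norm a)).
rewrite -sqrtr_sqr ler_wsqrtr//.
by near: L; exact: near_ln_ge.
Unshelve. all: by end_near. Qed.

Lemma normalized_sum_cvg_normal : cvg_in_law_real
  (fun L => distribution P (normalized_sum (fun N => real_position (X N)) L))
  (normal_prob 0 1).
Proof.
move=> f [cf [M fM]].
have mf : measurable_fun [set: R] f by exact: continuous_measurable_fun.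
rewrite (integral_normal_prob mf fM).
apply: cvg_trans (near_eq_cvg (f := fun L =>
  (smears id (survival_prob p) (@deviation R) (B L)^-1 (index_iota 3 L.+1) f 0)%:E) _) _.
  by apply: nearW => L; rewrite (integral_normalized_sum X_law X_indep L mf fM).
apply: cvg_EFin; first by apply: nearW.
have p01 := half01 R.
pose D := leq 3.
have w0 N i : D N -> (i < id N)%N -> 0 <= survival_prob p N i.
  by move=> _ _; exact: survival_prob_ge0.
have w1 N : D N -> \sum_(i < id N) survival_prob p N i = 1.
  case: N => // N _; rewrite -[RHS](mean_cst p N 1); apply: eq_bigr => i _.
  by rewrite mulr1.
have h1 N i : D N -> (i < id N)%N -> `|deviation R N i| <= 1.
  move=> N3 iN; have N0 : (0 : R) < N%:R by rewrite ltr0n; exact: leq_trans N3.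
  have : 0 <= i%:R / N%:R :> R by rewrite divr_ge0.
  have : i%:R / N%:R <= 1 :> R by rewrite ler_pdivrMr// mul1r ler_nat ltnW.
  by rewrite /deviation ler_norml => a b; apply/andP; split; lra.
have [K K0 hK] := sum_moment1_bounded R.
apply/cvgrPdist_le => eta eta0.
have eta2 : 0 < eta / 2 by rewrite divr_gt0.
have [C C0 hC] := lindeberg_bounded_continuous w0 w1 h1 cf fM eta2.
pose T := C * (3 * K + 2).
have T0 : 0 <= T by rewrite mulr_ge0//; lra.
near=> L.
have B1 : 1 <= B L by near: L; exact: near_total_deviation_ge.
have BT : T / (eta / 2) <= B L by near: L; exact: near_total_deviation_ge.
have B0 : 0 < B L by lra.
set b := (B L)^-1.
have b0 : 0 < b by rewrite invr_gt0.
have b1 : b <= 1 by rewrite invf_le1.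
have D3 : all D (index_iota 3 L.+1).
  by apply/allP => j; rewrite mem_index_iota => /andP[].
pose S := \sum_(3 <= N < L.+1) spread id (survival_prob p) (@deviation R) N.
have S0 : 0 <= S.
  by have := B0; rewrite total_deviation_sqrt -/S sqrtr_gt0 => /ltW.
have bS : b ^+ 2 * S = 1.
  rewrite /b total_deviation_sqrt -/S exprVn sqr_sqrtr// mulVf// gt_eqF//.
  by have := B0; rewrite total_deviation_sqrt -/S sqrtr_gt0.
have b01 : 0 <= b <= 1 by rewrite (ltW b0).
rewrite distrC; apply: le_trans (hC b _ D3 b01 bS) _.
have -> : \sum_(N <- index_iota 3 L.+1) step_error id (survival_prob p) (@deviation R) b N =
    3 * b * (\sum_(3 <= N < L.+1) `|moment1 id (survival_prob p) (@deviation R) N|) +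
    2 * b * (b ^+ 2 * S).
  rewrite /step_error big_split/= -!big_distrr/=; congr (_ + _).
  by rewrite /S; ring.
rewrite bS mulr1.
have : C * (3 * b * (\sum_(3 <= N < L.+1) `|moment1 id (survival_prob p) (@deviation R) N|) + 2 * b)
    <= T * b.
  rewrite /T -[leRHS]mulrA ler_wpM2l// [leRHS]mulrDl lerD2r mulrAC ler_wpM2r ?(ltW b0)//.
  by rewrite ler_wpM2l.
have : T * b <= eta / 2.
  by rewrite /b ler_pdivrMr// mulrC -ler_pdivrMr.
lra.
Unshelve. all: by end_near. Qed.

End central_limit.

Theorem theorem1p1 (R : realType) :
  (forall (p : R) (d : nat -> measure_display)
      (Omega : forall N, measurableType (d N))
      (P : forall N, probability (Omega N) R)
      (X : forall N, {RV (P N) >-> circle R}),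
    0 < p < 1 ->
    (forall N, (3 <= N)%N -> is_survivor_position p N (X N)) ->
    [/\ exists (d' : measure_display) (Omega' : measurableType d')
            (Q : probability Omega' R) (Y : {RV Q >-> circle R}),
          cvg_in_law_circle (fun N => distribution (P N) (X N))
            (distribution Q Y),
        exists (d' : measure_display) (Omega' : measurableType d')
            (Q : probability Omega' R) (Y : {RV Q >-> circle R}),
          cvg_in_law_circle (fun N => distribution (P N) (X N))
            (distribution Q Y) /\
          Q (Y @^-1` [set to_circle 0; to_circle (1 / 2)]) = 1%E
      & 1 / 3 < p < 2 / 3 -> cvg_in_probability_cst X (to_circle (1 / 2))])
  /\
  (forall (d : measure_display) (Omega : measurableType d)
      (P : probability Omega R) (X : nat -> {RV P >-> circle R}),
    (forall N, (3 <= N)%N -> is_survivor_position (1 / 2) N (X N)) ->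
    mutually_independent [set N | (3 <= N)%N] (fun N => real_position (X N)) ->
    let B := total_deviation (fun N => real_position (X N)) in
    cvg_in_law_real
      (fun L => distribution P
        (normalized_sum (fun N => real_position (X N)) L))
      (normal_prob 0 1) /\
    exists c C : R, [/\ 0 < c, c < C
      & \forall L \near \oo, c <= B L / Num.sqrt (ln L%:R) <= C]).
Proof.
split=> [p d Omega P X p01 X_law|d Omega P X X_law X_indep B].
  have lim := @cvg_in_law_half R p p01 d Omega P X X_law _ (circle R)
    (\d_(to_circle (1 / 2) : circle R)).
  split.
  - by do 4!eexists; exact: lim.
  - do 4!eexists; split; first exact: lim.
    by rewrite (_ : _ @^-1` _ = setT) ?probability_setT//; apply/seteqP; split => // x _; right.
  - by move=> _; exact: (@cvg_in_probability_half R p p01 d Omega P X X_law).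
split; first exact: (normalized_sum_cvg_normal X_law X_indep).
exists 1, 2; split => //; first by rewrite ltr1n.
near=> L.
have [l0 /andP[h1 h2]] : 0 < ln (L%:R : R) /\
    Num.sqrt (ln (L%:R : R)) <= B L <= 2 * Num.sqrt (ln (L%:R : R)).
  by near: L; exact: (total_deviation_log X_law).
have s0 : 0 < Num.sqrt (ln (L%:R : R)) by rewrite sqrtr_gt0.
by rewrite ler_pdivlMr// mul1r h1 ler_pdivrMr.
Unshelve. all: by end_near. Qed.
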